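(* Let $\mathcal{H}$ be a Hopf algebroid over $R$ and let $\mathcal{F}\in\mathcal{H}\otimes_R\mathcal{H}$ be a twistor of $\mathcal{H}$, with twisted Hopf algebroid $\mathcal{H}_{\mathcal{F}}=(\mathcal{H},\alpha_{\mathcal{F}},\beta_{\mathcal{F}},\cdot,\Delta_{\mathcal{F}},\epsilon)$ over $R_{\mathcal{F}}$. Let $$B_\infty(\mathcal{H}_{\mathcal{F}})=\Bigl(\bigoplus_{n\ge0}\mathcal{H}_{\mathcal{F}}^{\otimes_{R_{\mathcal{F}}}n}[-n],\ \delta_{\mathcal{H}_{\mathcal{F}}},\ \cup,\ \{\mu_k^{\Delta_{\mathcal{F}}}\}_{k\ge0}\Bigr)$$ be the canonical brace $B_\infty$ algebra of $\mathcal{H}_{\mathcal{F}}$ (type I twisted brace $B_\infty$ algebra), and let $$B_\infty(\mathcal{H})^{\mathcal{F}}=\Bigl(\bigoplus_{n\ge0}\mathcal{H}^{\otimes_Rn}[-n],\ [\mathcal{F},\,\cdot\,]_{\mathrm G},\ \cup_{\mathcal{F}},\ \{\mu_k^{\Delta}\}_{k\ge0}\Bigr),\qquad x\cup_{\mathcal{F}}y:=(-1)^{|x|}\mathcal{F}\{x,y\},$$ be the type II twisted brace $B_\infty$ algebra, with the same braces as $B_\infty(\mathcal{H})$. Then the $\mathbb{K}$-linear map $$\mathcal{F}^\sharp:B_\infty(\mathcal{H}_{\mathcal{F}})\to B_\infty(\mathcal{H})^{\mathcal{F}},\qquad x_1\otimes_{R_{\mathcal{F}}}\cdots\otimes_{R_{\mathcal{F}}}x_n\mapsto\mathcal{F}\{\mathcal{F}\{\cdots\mathcal{F}\{\mathcal{F}\{x_1,x_2\},x_3\},\cdots\},x_n\}$$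 ($n\ge0$, $x_i\in\mathcal{H}$; the identity for $n=0,1$) is a strict $B_\infty$ isomorphism.
   Context: $\mathbb{K}$ is a field of characteristic zero, $\otimes=\otimes_{\mathbb{K}}$; for graded $W$, $(W[k])^i=W^{i+k}$. **Hopf algebroid** over a unital associative $\mathbb{K}$-algebra $R$ (in the sense of Xu): $(\mathcal{H},\alpha,\beta,\cdot,\Delta,\epsilon)$ where (1) $(\mathcal{H},\cdot)$ is a unital associative $\mathbb{K}$-algebra; (2) $\alpha:R\to\mathcal{H}$ is an algebra homomorphism and $\beta:R\to\mathcal{H}$ an algebra anti-homomorphism with $\alpha(a)\beta(b)=\beta(b)\alpha(a)$; $\mathcal{H}$ is an $(R,R)$-bimodule via $a\cdot x=\alpha(a)x$, $x\cdot b=\beta(b)x$; (3) $\Delta:\mathcal{H}\to\mathcal{H}\otimes_R\mathcal{H}$ is an $(R,R)$-bimodule map with $\Delta(1)=1\otimes_R1$ and $(\Delta\otimes_R\mathrm{id})\Delta=(\mathrm{id}\otimes_R\Delta)\Delta$; (4) $\Delta(x)\cdot(\beta(a)\otimes1-1\otimes\alpha(a))=0$ (right multiplication by $\mathcal{H}\otimes\mathcal{H}$), and $\Delta(x_1x_2)=\Delta(x_1)\cdot\Delta(x_2)$; (5) $\epsilon:\mathcal{H}\to R$ is an $(R,R)$-bimodule map with $\epsilon(1)=1$ and $(\epsilon\otimes_R\mathrm{id})\Delta=(\mathrm{id}\otimes_R\epsilon)\Delta=\mathrm{id}$; (6) $\ker\epsilon$ is a left ideal of $\mathcal{H}$. $R$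 is a left $\mathcal{H}$-module via $x\rhd a=\epsilon(x\alpha(a))=\epsilon(x\beta(a))$. $\mathcal{H}^{\otimes_Rn}$ is the $n$-fold tensor product over $R$ ($\mathcal{H}^{\otimes_R0}=R$), with right action of $\mathcal{H}^{\otimes n}$ by factorwise right multiplication. $\Delta^0=\mathrm{id}$, $\Delta^n=(\Delta^{n-1}\otimes_R\mathrm{id})\Delta$. For $h\in\mathcal{H}$, $u\in\mathcal{H}^{\otimes_Rn}$: $(\Delta^{n-1}h)\cdot u:=\Delta^{n-1}(h)\cdot\tilde u$ for any lift $\tilde u\in\mathcal{H}^{\otimes n}$ of $u$ if $n\ge1$ (independent of lift), and $h\rhd u\in R$ if $n=0$. **Canonical brace $B_\infty$ algebra $B_\infty(\mathcal{H})$**: on $\bigoplus_n\mathcal{H}^{\otimes_Rn}[-n]$ (elements of $\mathcal{H}^{\otimes_Rn}$ have degree $n$): $\delta_{\mathcal{H}}(x_1\otimes_R\cdots\otimes_Rx_n)=x_1\otimes_R\cdots\otimes_Rx_n\otimes_R1-\sum_{i=1}^n(-1)^{n-i}x_1\otimes_R\cdots\otimes_R\Delta(x_i)\otimes_R\cdots\otimes_Rx_n-(-1)^n1\otimes_Rx_1\otimes_R\cdots\otimes_Rx_n$; $x\cup y=(-1)^{|x||y|}x\otimes_Ry$; braces $x\{y_1,\dots,y_k\}=\mu_k^\Delta(x\otimes y_1[1]\otimes\cdots\otimes y_k[1])$ given for $x=x_1\otimes_R\cdots\otimes_Rx_p$, $y_i\in\mathcal{H}^{\otimes_Rq_i}$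 by $$\sum_{1\le j_1<\cdots<j_k\le p}(-1)^{\sum_{l}(j_l-l+q_1+\cdots+q_{l-1})(q_l-1)}x_1\otimes_R\cdots\otimes_R((\Delta^{q_1-1}x_{j_1})\cdot y_1)\otimes_R\cdots\otimes_R((\Delta^{q_k-1}x_{j_k})\cdot y_k)\otimes_R\cdots\otimes_Rx_p$$ if $p\ge k$, and $0$ if $p<k$. The Gerstenhaber bracket is $[x,y]_{\mathrm G}=x\{y\}-(-1)^{(|x|+1)(|y|+1)}y\{x\}$. **Twistor.** For $\mathcal{F}=\mathcal{F}_1\otimes_R\mathcal{F}_2\in\mathcal{H}\otimes_R\mathcal{H}$ (summation suppressed) put $\alpha_{\mathcal{F}}(a)=\alpha(\mathcal{F}_1\rhd a)\mathcal{F}_2$, $\beta_{\mathcal{F}}(a)=\beta(\mathcal{F}_2\rhd a)\mathcal{F}_1$, $a\star_{\mathcal{F}}b=(\mathcal{F}_1\rhd a)(\mathcal{F}_2\rhd b)$. If $(\Delta(\mathcal{F}_1)\cdot\mathcal{F})\otimes_R\mathcal{F}_2=\mathcal{F}_1\otimes_R(\Delta(\mathcal{F}_2)\cdot\mathcal{F})$ (i.e. $(\Delta\otimes_R\mathrm{id})\mathcal{F}\cdot(\mathcal{F}\otimes_R1)=(\mathrm{id}\otimes_R\Delta)\mathcal{F}\cdot(1\otimes_R\mathcal{F})$) and $(\epsilon\otimes_R\mathrm{id})\mathcal{F}=(\mathrm{id}\otimes_R\epsilon)\mathcal{F}=1$, then $R_{\mathcal{F}}=(R,\star_{\mathcal{F}})$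 is a unital associative algebra, $\alpha_{\mathcal{F}}$ (resp. $\beta_{\mathcal{F}}$) is an algebra (anti-)homomorphism $R_{\mathcal{F}}\to\mathcal{H}$ with commuting images, and for left $\mathcal{H}$-modules $M_1,M_2$ the map $\mathcal{F}^\sharp:M_1\otimes_{R_{\mathcal{F}}}M_2\to M_1\otimes_RM_2$, $D_1\otimes D_2\mapsto\mathcal{F}_1D_1\otimes_R\mathcal{F}_2D_2$ is well defined (modules are bimodules via source and target maps). $\mathcal{F}$ is a twistor if both conditions hold and all these maps $\mathcal{F}^\sharp$ are invertible. Then $\mathcal{H}_{\mathcal{F}}=(\mathcal{H},\alpha_{\mathcal{F}},\beta_{\mathcal{F}},\cdot,\Delta_{\mathcal{F}},\epsilon)$ with $\Delta_{\mathcal{F}}(x)=(\mathcal{F}^\sharp)^{-1}(\Delta(x)\cdot\mathcal{F})$ is a Hopf algebroid over $R_{\mathcal{F}}$. **Strict $B_\infty$ morphism** between brace $B_\infty$ algebras $(W,d,\cdot,\{\mu_k\})$: a degree-preserving $\mathbb{K}$-linear map commuting with the differentials, products and all braces $\mu_k$; it is a strict $B_\infty$ isomorphism if it is moreover bijective. *)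

(* Defs.v *)
From HB Require Import structures.
From mathcomp Require Import all_boot all_order all_algebra generic_quotient.
From mathcomp Require Import ring_quotient boolp classical_sets.
From mathcomp Require Import freeg.

Set Implicit Arguments.
Unset Strict Implicit.
Unset Printing Implicit Defensive.

Import GRing.Theory.
Local Open Scope ring_scope.
Local Open Scope quotient_scope.

Section Presentation.
Variables (K : fieldType) (X : choiceType) (rel : {freeg X / K} -> Prop).

Definition relspan : {pred {freeg X / K}} := fun v => `[<
  exists2 s : seq (K * {freeg X / K}),
    forall p, p \in s -> rel p.2 & v = \sum_(p <- s) p.1 *: p.2 >].

Lemma relspanZD c u v : u \in relspan -> v \in relspan ->
  c *: u + v \in relspan.
Proof.
move=> /asboolP[s hs ->] /asboolP[t ht ->]; apply/asboolP.
exists ([seq (c * p.1, p.2) | p <- s] ++ t) => [p|].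
  by rewrite mem_cat => /orP[/mapP[q qs ->]|/ht //]; exact: (hs q).
rewrite big_cat big_map scaler_sumr; congr (_ + _).
by apply: eq_bigr => p _; rewrite scalerA.
Qed.

Lemma relspan0 : 0 \in relspan.
Proof. by apply/asboolP; exists [::] => //; rewrite big_nil. Qed.

Lemma relspan_zmod_closed : zmod_closed relspan.
Proof.
split=> [|u v hu hv]; first exact: relspan0.
by rewrite addrC -scaleN1r; exact: relspanZD.
Qed.

HB.instance Definition _ :=
  GRing.isZmodClosed.Build {freeg X / K} relspan relspan_zmod_closed.

(* The K-module presented by the generators X and the relators rel. *)
Definition pres : Type := Quotient.quot relspan.

HB.instance Definition _ := GRing.Zmodule.on pres.

Definition prescl (v : {freeg X / K}) : pres := \pi_(Quotient.quot relspan) v.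

Definition presrepr (t : pres) : {freeg X / K} :=
  repr (t : Quotient.quot relspan).

Lemma presreprK : cancel presrepr prescl.
Proof. by move=> t; rewrite /prescl /presrepr reprK. Qed.

Lemma prescl_eq u v : prescl u = prescl v <-> u - v \in relspan.
Proof. by rewrite (Quotient.idealrBE relspan); split=> [|]/eqP. Qed.

Lemma presclB u v : prescl (u - v) = prescl u - prescl v.
Proof. by rewrite /prescl raddfB. Qed.

Lemma presclD u v : prescl (u + v) = prescl u + prescl v.
Proof. by rewrite /prescl raddfD. Qed.

Definition pscale (c : K) (t : pres) : pres := prescl (c *: presrepr t).

Lemma pscaleE c v : pscale c (prescl v) = prescl (c *: v).
Proof.
apply/prescl_eq; rewrite -scalerBr -[_ *: _]addr0.
by apply: relspanZD relspan0; apply/prescl_eq; exact: presreprK.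
Qed.

Lemma pscaleA a b t : pscale a (pscale b t) = pscale (a * b) t.
Proof. by rewrite -(presreprK t) !pscaleE scalerA. Qed.

Lemma pscale1 : left_id 1 pscale.
Proof. by move=> t; rewrite -(presreprK t) pscaleE scale1r. Qed.

Lemma pscaleDr : right_distributive pscale +%R.
Proof.
move=> a t u; rewrite -(presreprK t) -(presreprK u) -presclD !pscaleE.
by rewrite scalerDr presclD.
Qed.

Lemma pscaleDl t : {morph pscale^~ t : a b / a + b}.
Proof.
by move=> a b; rewrite -(presreprK t) !pscaleE scalerDl presclD.
Qed.

HB.instance Definition _ :=
  GRing.Zmodule_isLmodule.Build K pres pscaleA pscale1 pscaleDr pscaleDl.

Definition pgen (x : X) : pres := prescl << x >>.

(* The K-linear map sending the generator x to f x: it is evaluated on a chosen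
   representative, and is only meaningful when f respects the relators; see
   plift_prescl. *)
Definition plift (V : lmodType K) (f : X -> V) (t : pres) : V :=
  fglift f (presrepr t).

Lemma plift_prescl (V : lmodType K) (f : X -> V) :
  (forall v, rel v -> fglift f v = 0) ->
  forall v, plift f (prescl v) = fglift f v.
Proof.
move=> hf v; apply/eqP; rewrite -subr_eq0 /plift.
have fB : additive (fglift f) := lift_is_additive f.
pose fa := GRing.isZmodMorphism.Build _ _ (fglift f) fB.
pose g : {additive {freeg X / K} -> V} := HB.pack (fglift f) fa.
have gZ c u : g (c *: u) = c *: g u.
  rewrite -{1}(freeg_sumE u) scaler_sumr !raddf_sum -[in RHS](freeg_sumE u).
  rewrite raddf_sum scaler_sumr; apply: eq_bigr => x _ /=.
  suff -> : c *: << coeff x u *g x >> = << c * coeff x u *g x >> :> {freeg X / K}.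
    by rewrite !liftU scalerA.
  by apply/eqP/freeg_eqP => y; rewrite coeffZ !coeffU mulrA.
rewrite -[_ - _]/(g (presrepr (prescl v)) - g v) -raddfB.
have /asboolP[s hs ->] : presrepr (prescl v) - v \in relspan.
  by apply/prescl_eq; exact: presreprK.
rewrite raddf_sum big_seq big1 // => p ps.
by rewrite gZ /= hf ?scaler0 //; exact: hs.
Qed.

End Presentation.

(* M (x)_R N for left H-modules M and N, seen as (R, R)-bimodules through a
   source map al and a target map be: r . m = al r *: m, m . r = be r *: m. *)
Section TensorOverBase.
Variables (K : fieldType) (R : Type) (H : algType K) (al be : R -> H).
Variables M N : lmodType H.

Inductive tens_rel : {freeg (M * N) / K} -> Prop :=
| TensLinL c m m' n :
    tens_rel (<< (c%:A *: m + m', n) >> - c *: << (m, n) >> - << (m', n) >>)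
| TensLinR c m n n' :
    tens_rel (<< (m, c%:A *: n + n') >> - c *: << (m, n) >> - << (m, n') >>)
| TensBal r m n :
    tens_rel (<< (be r *: m, n) >> - << (m, al r *: n) >>).

Definition tens : lmodType K := pres tens_rel.

Definition tpair (m : M) (n : N) : tens := pgen tens_rel (m, n).

End TensorOverBase.

Definition htens (K : fieldType) (R : Type) (H : algType K) (al be : R -> H) :
  lmodType K := tens al be H^o H^o.

Section HTensor.
Variables (K : fieldType) (R : Type) (H : algType K) (al be : R -> H).

Definition hpair (x y : H) : htens al be := tpair al be (x : H^o) (y : H^o).

Definition hlift (V : lmodType K) (f : H -> H -> V) (t : htens al be) : V :=
  plift (fun p : H^o * H^o => f p.1 p.2) t.

(* right multiplication by u (x) v in H (x) H *)
Definition hrmul (t : htens al be) (u v : H) : htens al be :=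
  hlift (fun x y => hpair (x * u) (y * v)) t.

(* t . u, for any lift of u to H (x) H *)
Definition hmul (t u : htens al be) : htens al be := hlift (hrmul t) u.

End HTensor.

(* The structure maps of a Hopf algebroid over R. The product and the unit of
   the base are part of the data, and not an algType structure on R, because a
   twist replaces the product on the same module R. *)
Record hopf_data (K : fieldType) (R : lmodType K) (H : algType K) := HopfData {
  bmul : R -> R -> R;
  bone : R;
  src : R -> H;
  tgt : R -> H;
  comul : H -> htens src tgt;
  counit : H -> R
}.

(* x |> a *)
Definition hact (K : fieldType) (R : lmodType K) (H : algType K)
  (D : hopf_data R H) (x : H) (a : R) : R := counit D (x * src D a).

(* The total space R + H + H (x)_R H + ...: the pair (r, t) has degree-0 part r,
   and the positive part is presented by the nonempty words x1 ... xn over H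
   (encoded as x1 together with x2 ... xn) standing for x1 (x)_R ... (x)_R xn;
   the relators are homogeneous for the length. *)
Section TensorPowers.
Variables (K : fieldType) (R : lmodType K) (H : algType K) (D : hopf_data R H).

Definition fword (s : seq H) : {freeg (H * seq H) / K} :=
  if s is x :: s' then << (x, s') >> else 0.

Inductive word_rel : {freeg (H * seq H) / K} -> Prop :=
| WordLin c x y s1 s2 :
    word_rel (fword (s1 ++ (c *: x + y) :: s2)
              - c *: fword (s1 ++ x :: s2) - fword (s1 ++ y :: s2))
| WordBal r x y s1 s2 :
    word_rel (fword (s1 ++ [:: tgt D r * x, y & s2])
              - fword (s1 ++ [:: x, src D r * y & s2])).

Definition tpow : lmodType K := (R * pres word_rel)%type.

(* the component of degree n *)
Definition homog (n : nat) (t : tpow) : Prop :=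
  if n is m.+1 then
    t.1 = 0 /\ exists2 v : {freeg (H * seq H) / K},
      (forall w, w \in dom v -> size w.2 = m) & t.2 = prescl word_rel v
  else t.2 = 0.

Definition inR (r : R) : tpow := (r, 0).

(* x1 (x)_R ... (x)_R xn; the empty tensor is the unit of R *)
Definition ten (s : seq H) : tpow :=
  if s is x :: s' then (0, pgen word_rel (x, s')) else inR (bone D).

Definition inH (x : H) : tpow := ten [:: x].

(* Generators: elements of R in degree 0, nonempty words in positive degree. *)
Definition gen : Type := (R + seq H)%type.

Definition gval (g : gen) : tpow :=
  match g with inl r => inR r | inr s => ten s end.

Definition gdeg (g : gen) : nat :=
  match g with inl _ => 0%N | inr s => size s end.

Definition tlift (V : lmodType K) (f : gen -> V) (t : tpow) : V :=
  f (inl t.1) + plift (fun w => f (inr (w.1 :: w.2))) t.2.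

Definition emb2 (t : htens (src D) (tgt D)) : tpow :=
  hlift (fun x y => ten [:: x; y]) t.

(* the product (x)_R of the tensor algebra of the bimodule H *)
Definition gcat (g g' : gen) : tpow :=
  match g, g' with
  | inl r, inl r' => inR (bmul D r r')
  | inl r, inr s' => ten (if s' is x :: u then src D r * x :: u else [::])
  | inr s, inl r' =>
      ten (if s is x :: u then rcons (belast x u) (tgt D r' * last x u)
           else [::])
  | inr s, inr s' => ten (s ++ s')
  end.

Definition tcat (t u : tpow) : tpow := tlift (fun g => tlift (gcat g) u) t.

(* Delta^n *)
Fixpoint icomul (n : nat) (h : H) : tpow :=
  if n is m.+1 then
    hlift (fun x y => tcat (icomul m x) (inH y)) (comul D h)
  else inH h.

(* right multiplication by w1 (x) ... (x) wn in the n-fold tensor power over K *)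
Definition tact (t : tpow) (w : seq H) : tpow :=
  tlift (fun g => if g is inr s then
           if size s == size w then ten [seq p.1 * p.2 | p <- zip s w] else 0
         else 0) t.

(* (Delta^(n-1) h) . u for a generator u of degree n *)
Definition dact (h : H) (u : gen) : tpow :=
  match u with
  | inl r => inR (hact D h r)
  | inr w => tact (icomul (size w).-1 h) w
  end.

Definition gdiff (g : gen) : tpow :=
  tcat (gval g) (inH 1)
  - (if g is inr s then
       \sum_(i < size s) (-1) ^+ (size s - i.+1) *:
         tcat (tcat (ten (take i s)) (emb2 (comul D s`_i)))
              (ten (drop i.+1 s))
     else 0)
  - (-1) ^+ gdeg g *: tcat (inH 1) (gval g).

Definition tdiff : tpow -> tpow := tlift gdiff.

Definition tcup (t u : tpow) : tpow :=
  tlift (fun g => tlift (fun g' =>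
    (-1) ^+ (gdeg g * gdeg g') *: tcat (gval g) (gval g')) u) t.

(* Indices start at 0, which leaves the differences j l - l unchanged, and
   q l - 1 is replaced by q l + 1, which has the same parity and is a nat. *)
Definition gbrace (g : gen) (ys : seq gen) : tpow :=
  let k := size ys in
  let y (l : nat) := nth (inl 0) ys l in
  match g with
  | inl r => if k == 0%N then inR r else 0
  | inr s =>
      \sum_(j : {ffun 'I_k -> 'I_(size s)}
             | [forall l : 'I_k, forall l' : 'I_k, (l < l')%N ==> (j l < j l')%N])
        (-1) ^+ (\sum_(l < k) (j l - l + \sum_(l' < k | (l' < l)%N) gdeg (y l'))
                              * (gdeg (y l)).+1)%N *:
          \big[tcat/inR (bone D)]_(i < size s)
             (if [pick l | j l == i] is Some l then dact s`_i (y l)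
              else inH s`_i)
  end.

Fixpoint mlift (V : lmodType K) (f : seq gen -> V) (ts : seq tpow) : V :=
  if ts is t :: ts' then tlift (fun g => mlift (fun gs => f (g :: gs)) ts') t
  else f [::].

(* t{u1, ..., uk} *)
Definition tbrace (t : tpow) (us : seq tpow) : tpow :=
  tlift (fun g => mlift (gbrace g) us) t.

Definition gerst (t u : tpow) : tpow :=
  tlift (fun g => tlift (fun g' =>
    tbrace (gval g) [:: gval g']
    - (-1) ^+ ((gdeg g).+1 * (gdeg g').+1) *: tbrace (gval g') [:: gval g])
    u) t.

End TensorPowers.

Record hopf_algebroid (K : fieldType) (R : lmodType K) (H : algType K)
    (D : hopf_data R H) : Prop := HopfAlgebroid {
  bmul_linl : forall b, linear (bmul D ^~ b);
  bmul_linr : forall a, linear (bmul D a);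
  bmulA : associative (bmul D);
  bmul1l : left_id (bone D) (bmul D);
  bmul1r : right_id (bone D) (bmul D);
  src_lin : linear (src D);
  src1 : src D (bone D) = 1;
  srcM : forall a b, src D (bmul D a b) = src D a * src D b;
  tgt_lin : linear (tgt D);
  tgt1 : tgt D (bone D) = 1;
  tgtM : forall a b, tgt D (bmul D a b) = tgt D b * tgt D a;
  src_tgtC : forall a b, src D a * tgt D b = tgt D b * src D a;
  comul_lin : linear (comul D);
  comul_src : forall a x, comul D (src D a * x) =
    hlift (fun y z => hpair (src D) (tgt D) (src D a * y) z) (comul D x);
  comul_tgt : forall b x, comul D (tgt D b * x) =
    hlift (fun y z => hpair (src D) (tgt D) y (tgt D b * z)) (comul D x);
  comul1 : comul D 1 = hpair (src D) (tgt D) 1 1;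
  comulA : forall x,
    hlift (fun y z => tcat (emb2 (comul D y)) (inH D z)) (comul D x) =
    hlift (fun y z => tcat (inH D y) (emb2 (comul D z))) (comul D x);
  comul_bal : forall x a,
    hrmul (comul D x) (tgt D a) 1 - hrmul (comul D x) 1 (src D a) = 0;
  comulM : forall x y, comul D (x * y) = hmul (comul D x) (comul D y);
  counit_lin : linear (counit D);
  counit_src : forall a x, counit D (src D a * x) = bmul D a (counit D x);
  counit_tgt : forall b x, counit D (tgt D b * x) = bmul D (counit D x) b;
  counit1 : counit D 1 = bone D;
  counitL : forall x,
    hlift (fun y z => src D (counit D y) * z) (comul D x) = x;
  counitR : forall x,
    hlift (fun y z => tgt D (counit D z) * y) (comul D x) = x;
  counit_ker : forall x y, counit D y = 0 -> counit D (x * y) = 0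
}.

Section Twist.
Variables (K : fieldType) (R : lmodType K) (H : algType K) (D : hopf_data R H).
Variable F : htens (src D) (tgt D).

Definition twsrc (a : R) : H := hlift (fun x y => src D (hact D x a) * y) F.

Definition twtgt (a : R) : H := hlift (fun x y => tgt D (hact D y a) * x) F.

Definition twmul (a b : R) : R :=
  hlift (fun x y => bmul D (hact D x a) (hact D y b)) F.

(* F^sharp : M (x)_(R_F) N -> M (x)_R N *)
Definition twsharp (M N : lmodType H) (t : tens twsrc twtgt M N) :
    tens (src D) (tgt D) M N :=
  plift (fun d : M * N =>
    hlift (fun x y => tpair (src D) (tgt D) (x *: d.1) (y *: d.2)) F) t.

Record twistor : Prop := Twistor {
  tw_cocycle :
    hlift (fun x y => tcat (emb2 (hmul (comul D x) F)) (inH D y)) F =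
    hlift (fun x y => tcat (inH D x) (emb2 (hmul (comul D y) F))) F;
  tw_counitL : hlift (fun x y => src D (counit D x) * y) F = 1;
  tw_counitR : hlift (fun x y => tgt D (counit D y) * x) F = 1;
  tw_inv : forall M N : lmodType H, bijective (@twsharp M N)
}.

(* (F^sharp)^-1 (Delta x . F); the default value 0 of xget is never used when F
   is a twistor. *)
Definition twcomul (x : H) : htens twsrc twtgt :=
  xget 0 [set t | twsharp t = hmul (comul D x) F].

Definition twist : hopf_data R H :=
  HopfData twmul (bone D) twcomul (counit D).

End Twist.

(* The data that strict B_infinity morphisms have to respect; bbrace x
   [:: y1; ...; yk] is mu_k (x (x) y1[1] (x) ... (x) yk[1]). *)
Record binf (K : fieldType) := Binf {
  bcar : lmodType K;
  bdeg : nat -> bcar -> Prop;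
  bdiff : bcar -> bcar;
  bprod : bcar -> bcar -> bcar;
  bbrace : bcar -> seq bcar -> bcar
}.

Definition strict_binf_morphism (K : fieldType) (A B : binf K)
    (f : bcar A -> bcar B) : Prop :=
  [/\ linear f,
      forall n x, bdeg n x -> bdeg n (f x),
      forall x, f (bdiff x) = bdiff (f x),
      forall x y, f (bprod x y) = bprod (f x) (f y) &
      forall x ys, f (bbrace x ys) = bbrace (f x) (map f ys)].

Definition strict_binf_iso (K : fieldType) (A B : binf K)
    (f : bcar A -> bcar B) : Prop :=
  strict_binf_morphism f /\ bijective f.

Section CanonicalBinf.
Variables (K : fieldType) (R : lmodType K) (H : algType K) (D : hopf_data R H).

Definition canonical_binf : binf K :=
  Binf (@homog _ _ _ D) (@tdiff _ _ _ D) (@tcup _ _ _ D) (@tbrace _ _ _ D).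

Variable F : htens (src D) (tgt D).

(* x cup_F y = (-1)^|x| F{x, y} *)
Definition tcupF (t u : tpow D) : tpow D :=
  tlift (fun g => (-1) ^+ gdeg g *: tbrace (emb2 F) [:: gval D g; u]) t.

(* type II twisted brace B_infinity algebra *)
Definition twisted_binf : binf K :=
  Binf (@homog _ _ _ D) (gerst (emb2 F)) tcupF (@tbrace _ _ _ D).

(* F{...F{F{x1, x2}, x3}..., xn}, with x = x1 and s = x2 ... xn *)
Definition iterbrace (x : H) (s : seq H) : tpow D :=
  foldl (fun t y => tbrace (emb2 F) [:: t; inH D y]) (inH D x) s.

End CanonicalBinf.

(* Main.v *)
From HB Require Import structures.
Require Import Defs.
From mathcomp Require Import all_boot all_order all_algebra.
From mathcomp Require Import boolp classical_sets freeg.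

Set Implicit Arguments.
Unset Strict Implicit.
Unset Printing Implicit Defensive.

Import GRing.Theory.
Local Open Scope ring_scope.

(** Let T be the total space of tensor powers of H over R, and T' that of the
    twisted Hopf algebroid. Because comul is multiplicative, H acts on T (act)
    with h . (A (x) B) = h1 A (x) h2 B. The twistor defines a second product
    A ** B = F1 A (x) F2 B on the space T (twcat). The cocycle equation and the
    counit conditions say precisely that ** is associative with unit 1_R
    (twcatA, twcat1l, twcat1r), and the twisted source and target maps are its
    left and right multiplications by elements of R. So the tensor algebra T'
    maps to T with this product by x1 ... xn |-> x1 ** ... ** xn (fsharp), and
    all compatibilities become statements about ** on T.

    - The coproduct of the twist is defined so that fsharp intertwines the
      actions: h . (A ** B) = Delta h . F . (A, B) (act_twcat_twcomul,
      fsharp_dact).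
    - The brace t{us} is linear for H in its first argument (rbrace_act): the
      coproduct of h splits over the factors of t in the same way whether or
      not arguments have been inserted. Hence the recursion that computes a
      brace of t (x) x from braces of t holds verbatim for t ** x
      (rbrace_twcat_app), and the braces of x1 ** ... ** xn are given by the
      formula that defines braces, with (x) replaced by **
      (rbrace_fsharp_word). This is fsharp_tbrace.
    - F{u, v} equals u ** v up to the expected sign (tbrace_E2), which settles
      the products and the iterated braces F{...F{x1, x2}..., xn}.
      In [F, u], the terms F{u} are the two outer terms of the differential and
      u{F} inserts x_i . F = Delta x_i . F at each place, which is the image of
      the twisted coproduct (tbrace_E1, rbrace_fsharp_word_E, fsharp_tdiff).
    - Invertibility of F^sharp is used once for H (x) H, to have the twisted
      coproduct, and once for T (x) H, where T is an H-module by act: every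
      element of positive degree of T comes from a unique element of
      T (x)_(R_F) H, so that the last letter can be split off and an inverse
      is built degree by degree (fsharp_inv, fsharp_bij).

    The operations on T' are evaluated on chosen representatives, that is on
    linear combinations of words. A linear map out of T' that transports such
    an operation to an operation on T already known to be multilinear
    therefore only has to be checked on words (presP, tlift_eval). The axioms
    established for the twist are those on its base algebra and its source and
    target maps (twist_base), on which the tensor algebra T' rests. *)

(** * Linear maps and presented modules *)

Section LinearMaps.
Variables (K : fieldType) (U V : lmodType K) (f : U -> V).
Hypothesis fL : linear f.

Lemma lin0 : f 0 = 0.
Proof. by have := fL (-1) 0 0; rewrite !scaleN1r oppr0 addr0 addNr. Qed.

Lemma linD u v : f (u + v) = f u + f v.
Proof. by have := fL 1 u v; rewrite !scale1r. Qed.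

Lemma linZ c u : f (c *: u) = c *: f u.
Proof. by have := fL c u 0; rewrite !addr0 lin0 addr0. Qed.

Lemma linN u : f (- u) = - f u.
Proof. by rewrite -scaleN1r linZ scaleN1r. Qed.

Lemma linB u v : f (u - v) = f u - f v.
Proof. by rewrite linD linN. Qed.

Lemma lin_sum I (r : seq I) (P : pred I) (F : I -> U) :
  f (\sum_(i <- r | P i) F i) = \sum_(i <- r | P i) f (F i).
Proof. by apply: (big_morph f linD lin0). Qed.

Lemma lin_comb I (r : seq I) (c : I -> K) (F : I -> U) :
  f (\sum_(i <- r) c i *: F i) = \sum_(i <- r) c i *: f (F i).
Proof. by rewrite lin_sum; apply: eq_bigr => i _; rewrite linZ. Qed.
End LinearMaps.

Section LinearClosure.
Variables (K : fieldType) (U V : lmodType K).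

Lemma linear_comp (W : lmodType K) (g : V -> W) (f : U -> V) :
  linear g -> linear f -> linear (fun u => g (f u)).
Proof. by move=> gL fL c u v; rewrite fL gL. Qed.

Lemma linear_add (f g : U -> V) :
  linear f -> linear g -> linear (fun u => f u + g u).
Proof. by move=> fL gL c u v; rewrite fL gL scalerDr addrACA. Qed.

Lemma linear_scale (a : K) (f : U -> V) :
  linear f -> linear (fun u => a *: f u).
Proof. by move=> fL c u v; rewrite fL scalerDr !scalerA mulrC. Qed.

Lemma linear_opp (f : U -> V) : linear f -> linear (fun u => - f u).
Proof. by move=> fL c u v; rewrite fL opprD scalerN. Qed.

Lemma linear_zero : linear (fun _ : U => 0 : V).
Proof. by move=> c u v; rewrite scaler0 addr0. Qed.

Lemma linear_id : linear (fun u : U => u).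
Proof. by []. Qed.

End LinearClosure.

Section Presentations.
Variables (K : fieldType) (X : choiceType) (rel : {freeg X / K} -> Prop).
Local Notation P := (pres rel).

Lemma fglift_linear (V : lmodType K) (f : X -> V) : linear (fglift f).
Proof.
have fB : additive (fglift f) := lift_is_additive f.
pose fa := GRing.isZmodMorphism.Build _ _ (fglift f) fB.
pose g : {additive {freeg X / K} -> V} := HB.pack (fglift f) fa.
move=> c u v; rewrite -[fglift f]/(g : _ -> _) raddfD; congr (_ + _).
rewrite -{1}(freeg_sumE u) scaler_sumr !raddf_sum -[in RHS](freeg_sumE u).
rewrite raddf_sum scaler_sumr; apply: eq_bigr => x _ /=.
suff -> : c *: << coeff x u *g x >> = << c * coeff x u *g x >> :> {freeg X / K}.
  by rewrite !liftU scalerA.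
by apply/eqP/freeg_eqP => y; rewrite coeffZ !coeffU mulrA.
Qed.

Lemma fgliftU (V : lmodType K) (f : X -> V) x : fglift f << x >> = f x.
Proof. by rewrite liftU scale1r. Qed.

Lemma prescl_linear : linear (prescl rel).
Proof. by move=> c u v; rewrite presclD -pscaleE. Qed.

(** Simultaneous expansion: one combination of generators represents t and
    computes every lift on t, whether or not the lifted function respects the
    relators. This is what allows naturality arguments for operations whose
    well-definedness is not known. *)
Lemma presP (t : P) : exists s : seq (K * X),
  t = \sum_(p <- s) p.1 *: pgen rel p.2 /\
  forall (V : lmodType K) (f : X -> V), plift f t = \sum_(p <- s) p.1 *: f p.2.
Proof.
pose v := presrepr t.
have fE (V : lmodType K) (f : X -> V) :
    fglift f v = \sum_(p <- [seq (coeff x v, x) | x <- dom v]) p.1 *: f p.2.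
  rewrite big_map -{1}(freeg_sumE v) (lin_sum (fglift_linear f)).
  by apply: eq_bigr => x _; rewrite liftU.
exists [seq (coeff x v, x) | x <- dom v]; split=> [|V f]; last exact: fE.
rewrite big_map -(presreprK t) -/v -{1}(freeg_sumE v) (lin_sum prescl_linear).
apply: eq_bigr => x _; rewrite /pgen -(linZ prescl_linear); congr prescl.
by apply/eqP/freeg_eqP => y; rewrite coeffZ !coeffU mul1r.
Qed.

Lemma pres_ext (V : lmodType K) (f g : P -> V) :
  linear f -> linear g -> (forall x, f (pgen rel x) = g (pgen rel x)) -> f =1 g.
Proof.
move=> fL gL fg t; have [s [-> _]] := presP t.
by rewrite !lin_comb //; apply: eq_bigr => p _; rewrite fg.
Qed.

(** A function on generators that extends to some linear map respects the
    relators, so the lift is that map. *)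
Lemma plift_eval (V : lmodType K) (f : X -> V) (g : P -> V) :
  linear g -> (forall x, f x = g (pgen rel x)) -> forall t, plift f t = g t.
Proof.
move=> gL fg t; have [s [-> _]] := presP t.
have [s' [e ->]] := presP (\sum_(p <- s) p.1 *: pgen rel p.2).
by rewrite e lin_comb //; apply: eq_bigr => p _; rewrite fg.
Qed.

Lemma plift_comp (V W : lmodType K) (g : V -> W) (f : X -> V) (t : P) :
  linear g -> g (plift f t) = plift (fun x => g (f x)) t.
Proof. by move=> gL; have [s [_ E]] := presP t; rewrite !E lin_comb. Qed.

Section Respectful.
Variables (V : lmodType K) (f : X -> V).
Hypothesis frel : forall v, rel v -> fglift f v = 0.

Lemma plift_linear : linear (plift f : P -> V).
Proof.
move=> c t u; rewrite -(presreprK t) -(presreprK u) -prescl_linear.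
by rewrite !(plift_prescl frel) fglift_linear.
Qed.

Lemma plift_pgen x : plift f (pgen rel x) = f x.
Proof. by rewrite /pgen (plift_prescl frel) fgliftU. Qed.
End Respectful.
End Presentations.

(** * Balanced maps on tensor products *)

Section BalancedTensors.
Variables (K : fieldType) (R : Type) (H : algType K) (al be : R -> H).
Variables M N : lmodType H.
Local Notation T := (tens al be M N).

(** Scalars of K act on M and N through H, whence c%:A; the three clauses are
    the three kinds of relators. *)
Record tens_balanced (V : lmodType K) (f : M -> N -> V) : Prop := TBalanced {
  tbal_l : forall c m m' n, f (c%:A *: m + m') n = c *: f m n + f m' n;
  tbal_r : forall c m n n', f m (c%:A *: n + n') = c *: f m n + f m n';
  tbal_m : forall r m n, f (be r *: m) n = f m (al r *: n)
}.

Lemma tens_balanced_rel (V : lmodType K) (f : M -> N -> V) : tens_balanced f ->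
  forall v, tens_rel al be v -> fglift (fun p : M * N => f p.1 p.2) v = 0.
Proof.
move=> fB v; set g := (fun p : M * N => _).
have gL := fglift_linear g.
case=> [c m m' n|c m n n'|r m n]; rewrite !(linB gL) ?(linZ gL) !fgliftU /g /=.
- by rewrite (tbal_l fB) addrAC addrK subrr.
- by rewrite (tbal_r fB) addrAC addrK subrr.
- by rewrite (tbal_m fB) subrr.
Qed.

Lemma tenslift_pair (V : lmodType K) (f : M -> N -> V) : tens_balanced f ->
  forall m n, plift (fun p : M * N => f p.1 p.2) (tpair al be m n) = f m n.
Proof. by move=> fB m n; rewrite plift_pgen //; apply: tens_balanced_rel. Qed.

Lemma tenslift_linear (V : lmodType K) (f : M -> N -> V) : tens_balanced f ->
  linear (plift (fun p : M * N => f p.1 p.2) : T -> V).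
Proof. by move=> fB; apply: plift_linear; apply: tens_balanced_rel. Qed.

Lemma tens_ext (V : lmodType K) (f g : T -> V) : linear f -> linear g ->
  (forall m n, f (tpair al be m n) = g (tpair al be m n)) -> f =1 g.
Proof. by move=> fL gL fg; apply: pres_ext => // -[m n]; apply: fg. Qed.

Lemma tpair_balanced : tens_balanced (@tpair _ _ _ al be M N).
Proof.
pose rl := @tens_rel K R H al be M N; pose cl : _ -> T := prescl rl.
have E u : rl u -> cl u = 0.
  move=> hu; rewrite -(lin0 (@prescl_linear _ _ rl)); apply/prescl_eq.
  rewrite subr0; apply/asboolP; exists [:: (1, u)].
    by move=> p; rewrite inE => /eqP ->.
  by rewrite big_seq1 scale1r.
have L : linear cl := @prescl_linear K _ rl.
have E3 c A B C : rl (A - c *: B - C) -> cl A = c *: cl B + cl C.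
  move=> /E; rewrite !(linB L) (linZ L) => /eqP.
  by rewrite subr_eq add0r subr_eq addrC => /eqP.
split=> [c m m' n|c m n n'|r m n].
- by apply: E3; apply: TensLinL.
- by apply: E3; apply: TensLinR.
- by apply/eqP; rewrite -subr_eq0 -(linB L); apply/eqP/E/TensBal.
Qed.
End BalancedTensors.

Section TensorSquare.
Variables (K : fieldType) (R : Type) (H : algType K) (al be : R -> H).
Local Notation T := (htens al be).
Local Notation hpair := (hpair al be).

Record balanced (V : lmodType K) (f : H -> H -> V) : Prop := Balanced {
  bal_l : forall y, linear (f ^~ y);
  bal_r : forall x, linear (f x);
  bal_m : forall r x y, f (be r * x) y = f x (al r * y)
}.

Lemma balanced_tens (V : lmodType K) (f : H -> H -> V) :
  balanced f -> tens_balanced al be (M := H^o) (N := H^o) f.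
Proof.
move=> fB; split=> [c m m' n|c m n n'|r m n]; last exact: (bal_m fB).
- by rewrite -(bal_l fB); congr f; congr (_ + _); exact: mulr_algl.
- by rewrite -(bal_r fB); congr f; congr (_ + _); exact: mulr_algl.
Qed.

Lemma hlift_pair (V : lmodType K) (f : H -> H -> V) : balanced f ->
  forall x y, hlift f (hpair x y) = f x y.
Proof. by move=> /balanced_tens fB x y; exact: (tenslift_pair fB). Qed.

Lemma hlift_linear (V : lmodType K) (f : H -> H -> V) : balanced f ->
  linear (hlift f : T -> V).
Proof. by move=> /balanced_tens fB; exact: (tenslift_linear fB). Qed.

Lemma htens_ext (V : lmodType K) (f g : T -> V) : linear f -> linear g ->
  (forall x y, f (hpair x y) = g (hpair x y)) -> f =1 g.
Proof. by move=> fL gL fg; apply: tens_ext. Qed.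

Lemma hpair_balanced : balanced (hpair : H -> H -> T).
Proof.
have B := tpair_balanced al be H^o H^o.
split=> [y c x x'|x c y y'|r x y].
- by rewrite -[c *: x]mulr_algl; exact: (tbal_l B).
- by rewrite -[c *: y]mulr_algl; exact: (tbal_r B).
- exact: (tbal_m B).
Qed.

Lemma hlift_comp (V W : lmodType K) (g : V -> W) (f : H -> H -> V) (t : T) :
  linear g -> g (hlift f t) = hlift (fun x y => g (f x y)) t.
Proof. by move=> gL; rewrite /hlift plift_comp. Qed.

Lemma hlift_eval (V : lmodType K) (f : H -> H -> V) (g : T -> V) :
  linear g -> (forall x y, f x y = g (hpair x y)) -> forall t, hlift f t = g t.
Proof. by move=> gL fg t; apply: plift_eval => // -[x y]; apply: fg. Qed.

Lemma eq_hlift (V : lmodType K) (f g : H -> H -> V) (t : T) :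
  (forall x y, f x y = g x y) -> hlift f t = hlift g t.
Proof. by move=> fg; congr hlift; do 2![apply: funext => ?]. Qed.

Lemma mulrl_linear (a : H) : linear (fun x => x * a).
Proof. by move=> c u v; rewrite mulrDl scalerAl. Qed.

Lemma mulrr_linear (a : H) : linear (fun x => a * x).
Proof. by move=> c u v; rewrite mulrDr scalerAr. Qed.

Lemma balanced_mulr (V : lmodType K) (f : H -> H -> V) u v :
  balanced f -> balanced (fun x y => f (x * u) (y * v)).
Proof.
move=> fB; split=> [y|x|r x y]; last by rewrite -!mulrA (bal_m fB).
- exact: (linear_comp (bal_l fB _) (mulrl_linear u)).
- exact: (linear_comp (bal_r fB _) (mulrl_linear v)).
Qed.

Lemma hrmul_pair x y u v : hrmul (hpair x y) u v = hpair (x * u) (y * v).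
Proof. exact/hlift_pair/balanced_mulr/hpair_balanced. Qed.

Lemma hrmul_linear u v : linear (fun t : T => hrmul t u v).
Proof. exact/hlift_linear/balanced_mulr/hpair_balanced. Qed.

Lemma hlift_hrmul (V : lmodType K) (f : H -> H -> V) (t : T) u v : balanced f ->
  hlift f (hrmul t u v) = hlift (fun x y => f (x * u) (y * v)) t.
Proof.
move=> fB; rewrite (hlift_comp _ _ (hlift_linear fB)).
by apply: eq_hlift => x y; rewrite hlift_pair.
Qed.

Lemma hrmulM (t : T) a b u v :
  hrmul (hrmul t a b) u v = hrmul t (a * u) (b * v).
Proof.
rewrite {1}/hrmul hlift_hrmul; last exact/balanced_mulr/hpair_balanced.
by apply: eq_hlift => x y; rewrite !mulrA.
Qed.

Lemma hrmul_linl (t : T) v : linear (fun u => hrmul t u v).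
Proof.
move=> c u u'; move: t; apply: htens_ext; first exact: hrmul_linear.
  exact: (linear_add (linear_scale c (hrmul_linear u v)) (hrmul_linear u' v)).
move=> x y; rewrite !hrmul_pair.
by rewrite (linear_comp (bal_l hpair_balanced _) (mulrr_linear x)).
Qed.

Lemma hrmul_linr (t : T) u : linear (fun v => hrmul t u v).
Proof.
move=> c v v'; move: t; apply: htens_ext; first exact: hrmul_linear.
  exact: (linear_add (linear_scale c (hrmul_linear u v)) (hrmul_linear u v')).
move=> x y; rewrite !hrmul_pair.
by rewrite (linear_comp (bal_r hpair_balanced _) (mulrr_linear y)).
Qed.
End TensorSquare.

(** * The total space of tensor powers *)

Section TensorPowers.
Variables (K : fieldType) (R : lmodType K) (H : algType K) (D : hopf_data R H).
Local Notation T := (tpow D).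
Local Notation ten := (ten D).
Local Notation inR := (inR D).
Local Notation inH := (inH D).

(** Multilinearity and balancedness of a function of nonempty words; it is the
    condition under which the function extends to the positive part. *)
Record word_balanced (V : lmodType K) (f : seq H -> V) : Prop := WBalanced {
  wbal_l : forall s1 s2, linear (fun x => f (s1 ++ x :: s2));
  wbal_m : forall r x y s1 s2,
    f (s1 ++ [:: tgt D r * x, y & s2]) = f (s1 ++ [:: x, src D r * y & s2])
}.

Lemma word_balanced_rel (V : lmodType K) (f : seq H -> V) : word_balanced f ->
  forall v, word_rel D v -> fglift (fun w : H * seq H => f (w.1 :: w.2)) v = 0.
Proof.
move=> fB v; set g := (fun w : H * seq H => _).
have gE s1 x s2 : fglift g (@fword K H (s1 ++ x :: s2)) = f (s1 ++ x :: s2).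
  by case: s1 => [|z s1] /=; rewrite fgliftU.
have gL := fglift_linear g.
case=> [c x y s1 s2|r x y s1 s2]; rewrite !(linB gL) ?(linZ gL) !gE.
- by rewrite (wbal_l fB) addrAC addrK subrr.
- by rewrite (wbal_m fB) subrr.
Qed.

Lemma inR_linear : linear (inR : R -> T).
Proof.
move=> c r r'; rewrite /inR.
have -> : c *: ((r, 0) : T) = (c *: r, c *: 0) by [].
by rewrite scaler0; congr (_, _); rewrite addr0.
Qed.

Lemma inR_inj : injective (inR : R -> T).
Proof. by move=> r r' []. Qed.

Lemma tpow_eta (t : T) : t = inR t.1 + (0, t.2).
Proof. by case: t => r u; congr pair; rewrite /= ?addr0 ?add0r. Qed.

Lemma snd_linear : linear (fun u : pres (word_rel D) => (0, u) : T).
Proof.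
move=> c u v.
have -> : c *: ((0, u) : T) = (c *: 0, c *: u) by [].
by rewrite scaler0; congr (_, _); rewrite addr0.
Qed.

(** The counterpart of plift_eval on the total space. Empty words never occur
    in a tensor, whence the restriction to words x :: s. *)
Lemma tlift_eval (V : lmodType K) (f : gen R H -> V) (G : T -> V) : linear G ->
  (forall r, f (inl r) = G (inR r)) ->
  (forall x s, f (inr (x :: s)) = G (ten (x :: s))) ->
  forall t, tlift f t = G t.
Proof.
move=> GL f1 f2 t; rewrite [in RHS](tpow_eta t) (linD GL) /tlift f1.
congr (_ + _); apply: (plift_eval (g := fun u => G (0, u))).
  exact: (linear_comp GL snd_linear).
by case=> x s; rewrite f2.
Qed.

Lemma tlift_comp (V W : lmodType K) (g : V -> W) (f : gen R H -> V) (t : T) :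
  linear g -> g (tlift f t) = tlift (fun x => g (f x)) t.
Proof. by move=> gL; rewrite /tlift (linD gL) plift_comp. Qed.

Lemma eq_tlift (V : lmodType K) (f g : gen R H -> V) (t : T) :
  (forall r, f (inl r) = g (inl r)) ->
  (forall x s, f (inr (x :: s)) = g (inr (x :: s))) -> tlift f t = tlift g t.
Proof.
move=> e1 e2; rewrite /tlift e1; congr (_ + plift _ _).
by apply: funext => -[x s]; rewrite e2.
Qed.

Record gen_balanced (V : lmodType K) (f : gen R H -> V) : Prop := GBalanced {
  gbal_l : linear (fun r => f (inl r));
  gbal_w : word_balanced (fun s => f (inr s))
}.

Section Lift.
Variables (V : lmodType K) (f : gen R H -> V).
Hypothesis fB : gen_balanced f.

Let fR v : word_rel D v ->
  fglift (fun w : H * seq H => f (inr (w.1 :: w.2))) v = 0.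
Proof. exact: (word_balanced_rel (gbal_w fB)). Qed.

Lemma tlift_linear : linear (tlift f : T -> V).
Proof.
move=> c t u; rewrite /tlift.
have -> : (c *: t + u).1 = c *: t.1 + u.1 by [].
have -> : (c *: t + u).2 = c *: t.2 + u.2 by [].
by rewrite (gbal_l fB) (plift_linear fR) scalerDr addrACA.
Qed.

Lemma tlift_inR r : tlift f (inR r) = f (inl r).
Proof. by rewrite /tlift /= (lin0 (plift_linear fR)) addr0. Qed.

Lemma tlift_ten x s : tlift f (ten (x :: s)) = f (inr (x :: s)).
Proof.
by rewrite /tlift /= (plift_pgen fR) (lin0 (gbal_l fB)) add0r.
Qed.
End Lift.

Lemma tpow_ext (V : lmodType K) (f g : T -> V) : linear f -> linear g ->
  (forall r, f (inR r) = g (inR r)) ->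
  (forall x s, f (ten (x :: s)) = g (ten (x :: s))) -> f =1 g.
Proof.
move=> fL gL e1 e2 t; rewrite -(tlift_eval (f := fun u => f (gval D u)) fL) //.
exact: tlift_eval.
Qed.

Lemma ten_word_balanced : word_balanced ten.
Proof.
pose cl := prescl (word_rel D).
have E u : word_rel D u -> cl u = 0.
  move=> hu; rewrite -(lin0 (@prescl_linear _ _ (word_rel D))).
  apply/prescl_eq; rewrite subr0; apply/asboolP; exists [:: (1, u)].
    by move=> p; rewrite inE => /eqP ->.
  by rewrite big_seq1 scale1r.
have L : linear cl := @prescl_linear K _ (word_rel D).
have tE s1 x s2 : ten (s1 ++ x :: s2) = (0, cl (@fword K H (s1 ++ x :: s2))).
  by case: s1.
split=> [s1 s2 c x y|r x y s1 s2]; rewrite !tE.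
  rewrite -snd_linear; congr (_, _).
  have /E := WordLin D c x y s1 s2; rewrite !(linB L) (linZ L) => /eqP.
  by rewrite subr_eq add0r subr_eq [X in _ == X]addrC => /eqP.
congr (_, _); apply/eqP; rewrite -subr_eq0 -(linB L); apply/eqP/E.
exact: WordBal.
Qed.

Lemma inH_linear : linear (inH : H -> T).
Proof. exact: (wbal_l ten_word_balanced [::] [::]). Qed.

(** The letter of a word of length one is recovered by the projection onto
    degree one, which is a legitimate lift. *)
Lemma inH_inj : injective (inH : H -> T).
Proof.
pose f (g : gen R H) : H^o := if g is inr [:: x] then x else 0.
have fB : gen_balanced f.
  split; first exact: linear_zero.
  split=> [s1 s2 c x y|r x y [|a [|b s1]] s2] //=.
  by case: s1 s2 => [|a [|b s1]] [|d s2] //=; rewrite ?scaler0 ?addr0.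
by move=> x y /(congr1 (tlift f)); rewrite !tlift_ten.
Qed.

Lemma emb2_balanced : balanced (src D) (tgt D) (fun x y => ten [:: x; y]).
Proof.
split=> [y|x|r x y].
- exact: (wbal_l ten_word_balanced [::] [:: y]).
- exact: (wbal_l ten_word_balanced [:: x] [::]).
- exact: (wbal_m ten_word_balanced r x y [::] [::]).
Qed.

Lemma emb2_linear : linear (@emb2 _ _ _ D).
Proof. exact/hlift_linear/emb2_balanced. Qed.

Lemma emb2_pair x y : emb2 (hpair (src D) (tgt D) x y) = ten [:: x; y].
Proof. exact/hlift_pair/emb2_balanced. Qed.
End TensorPowers.

Lemma hlift_add (K : fieldType) (R : Type) (H : algType K) (al be : R -> H)
    (V : lmodType K) (f g : H -> H -> V) (t : htens al be) :
  hlift (fun x y => f x y + g x y) t = hlift f t + hlift g t.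
Proof.
have [s [_ E]] := presP t; rewrite /hlift !E -big_split.
by apply: eq_bigr => p _; rewrite scalerDr.
Qed.

Section LiftParameters.
Variables (K : fieldType) (R : lmodType K) (H : algType K) (D : hopf_data R H).

(** A lift depends linearly on parameters even if it is not known to be
    well defined, since it is a fixed combination of values. *)
Lemma hlift_param (al be : R -> H) (U V : lmodType K) (F : U -> H -> H -> V)
    (t : htens al be) :
  (forall x y, linear (fun u => F u x y)) -> linear (fun u => hlift (F u) t).
Proof.
move=> FL c u v; have [s [_ E]] := presP t; rewrite /hlift !E.
rewrite scaler_sumr -big_split; apply: eq_bigr => p _.
by rewrite FL scalerDr !scalerA mulrC.
Qed.

Lemma tlift_param (U V : lmodType K) (F : U -> gen R H -> V) (t : tpow D) :
  (forall r, linear (fun u => F u (inl r))) ->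
  (forall x s, linear (fun u => F u (inr (x :: s)))) ->
  linear (fun u => tlift (F u) t).
Proof.
move=> F1 F2 c u v; have [s [_ E]] := presP t.2; rewrite /tlift !E.
rewrite F1 scalerDr addrACA; congr (_ + _).
rewrite scaler_sumr -big_split; apply: eq_bigr => -[a [x w]] _ /=.
by rewrite F2 scalerDr !scalerA mulrC.
Qed.

Lemma gen_balanced_tlift (V : lmodType K) (F : gen R H -> gen R H -> V)
    (t : tpow D) :
  (forall r, gen_balanced D (fun g => F g (inl r))) ->
  (forall x s, gen_balanced D (fun g => F g (inr (x :: s)))) ->
  gen_balanced D (fun g => tlift (F g) t).
Proof.
move=> F1 F2; split.
  by apply: tlift_param => [r|x s];
    [apply: (gbal_l (F1 r))|apply: (gbal_l (F2 x s))].
split=> [s1 s2|r x y s1 s2].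
  apply: tlift_param => [r|x s]; first exact: (wbal_l (gbal_w (F1 r))).
  exact: (wbal_l (gbal_w (F2 x s))).
apply: eq_tlift => [r'|x' s]; first exact: (wbal_m (gbal_w (F1 r'))).
exact: (wbal_m (gbal_w (F2 x' s))).
Qed.
End LiftParameters.

(** * The tensor algebra of the bimodule H *)

(** The axioms of a Hopf algebroid on which the product of the tensor algebra
    rests. They are isolated in order to be applied to the twist as well. *)
Record base_axioms (K : fieldType) (R : lmodType K) (H : algType K)
    (D : hopf_data R H) : Prop := BaseAxioms {
  ba_mull : forall b, linear (bmul D ^~ b);
  ba_mulr : forall a, linear (bmul D a);
  ba_mulA : associative (bmul D);
  ba_mul1 : left_id (bone D) (bmul D);
  ba_1mul : right_id (bone D) (bmul D);
  ba_src : linear (src D);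
  ba_src1 : src D (bone D) = 1;
  ba_srcM : forall a b, src D (bmul D a b) = src D a * src D b;
  ba_tgt : linear (tgt D);
  ba_tgt1 : tgt D (bone D) = 1;
  ba_tgtM : forall a b, tgt D (bmul D a b) = tgt D b * tgt D a;
  ba_comm : forall a b, src D a * tgt D b = tgt D b * src D a
}.

Section TensorAlgebra.
Variables (K : fieldType) (R : lmodType K) (H : algType K) (D : hopf_data R H).
Hypothesis hB : base_axioms D.
Local Notation T := (tpow D).
Local Notation ten := (ten D).
Local Notation inR := (inR D).
Local Notation inH := (inH D).
Local Notation gcat := (gcat D).

Let tw := ten_word_balanced D.

(** In the product with an element of the base on the right only the last
    letter changes, so words are best read as rcons s z. *)
Lemma gcat_wordR s z r :
  gcat (inr (rcons s z)) (inl r) = ten (rcons s (tgt D r * z)).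
Proof. by case: s => [|y s] //=; rewrite belast_rcons last_rcons. Qed.

Lemma gcat_balR r : gen_balanced D (fun g => gcat g (inl r)).
Proof.
split; first exact: (linear_comp (@inR_linear _ _ _ D) (ba_mull hB r)).
have E s1 x s2 z : gcat (inr (s1 ++ x :: rcons s2 z)) (inl r) =
    ten (s1 ++ x :: rcons s2 (tgt D r * z)).
  by rewrite -rcons_cons -rcons_cat gcat_wordR rcons_cat.
have E0 s1 x : gcat (inr (s1 ++ [:: x])) (inl r) = ten (s1 ++ [:: tgt D r * x]).
  by rewrite cats1 gcat_wordR cats1.
split=> [s1 s2|r' x y s1 s2].
  case/lastP: s2 => [|s2 z] c x y; last by rewrite !E (wbal_l tw).
  by rewrite !E0 mulrDr -scalerAr (wbal_l tw).
case/lastP: s2 => [|s2 z].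
  have E1 u v : gcat (inr (s1 ++ [:: u; v])) (inl r) =
      ten (s1 ++ [:: u, tgt D r * v & [::]])
        by rewrite -[X in s1 ++ _ :: X]/(rcons [::] v) E.
  by rewrite !E1 (wbal_m tw) !mulrA (ba_comm hB).
have E2 u v : gcat (inr (s1 ++ [:: u, v & rcons s2 z])) (inl r) =
    ten (s1 ++ [:: u, v & rcons s2 (tgt D r * z)]) by rewrite -rcons_cons E.
by rewrite !E2 (wbal_m tw).
Qed.

Lemma gcat_balW x u : gen_balanced D (fun g => gcat g (inr (x :: u))).
Proof.
split.
  have := wbal_l tw [::] u => tl; apply: (linear_comp tl).
  exact: (linear_comp (mulrl_linear x) (ba_src hB)).
split=> [s1 s2|r a b s1 s2].
  by move=> c a b /=; rewrite -!catA !cat_cons (wbal_l tw).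
by rewrite /= -!catA !cat_cons (wbal_m tw).
Qed.

Lemma gcat_balRr r : gen_balanced D (gcat (inl r)).
Proof.
split; first exact: (linear_comp (@inR_linear _ _ _ D) (ba_mulr hB r)).
split=> [[|a s1] s2|r' x y [|a s1] s2].
- have := wbal_l tw [::] s2 => tl; apply: (linear_comp tl).
  exact: mulrr_linear.
- exact: (wbal_l tw (src D r * a :: s1) s2).
- rewrite /= mulrA (ba_comm hB) -mulrA; exact: (wbal_m tw _ _ _ [::] _).
- exact: (wbal_m tw _ _ _ (src D r * a :: s1) s2).
Qed.

Lemma gcat_balWr a s : gen_balanced D (gcat (inr (a :: s))).
Proof.
split.
  case/lastP E: _ / (a :: s) => [|s' z] //.
  move=> c x y; rewrite !gcat_wordR (ba_tgt hB) mulrDl -scalerAl.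
  by rewrite -!cats1 (wbal_l tw).
split=> [s1 s2 c x y|r x y s1 s2] /=.
  by have := wbal_l tw ((a :: s) ++ s1) s2 c x y; rewrite -!catA.
by have := wbal_m tw r x y ((a :: s) ++ s1) s2; rewrite -!catA.
Qed.

Lemma tcat_linr (t : T) : linear (tcat t).
Proof.
apply: tlift_param => [r|x s]; apply: tlift_linear.
  exact: gcat_balRr.
exact: gcat_balWr.
Qed.

Let tcat_bal (u : T) : gen_balanced D (fun g => tlift (gcat g) u).
Proof. by apply: gen_balanced_tlift => *;
  [exact: gcat_balR | exact: gcat_balW]. Qed.

Lemma tcat_linl (u : T) : linear (fun t : T => tcat t u).
Proof. exact: tlift_linear. Qed.

Lemma tcat0l (u : T) : tcat 0 u = 0.
Proof. exact: (lin0 (tcat_linl u)). Qed.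

Lemma tcat_RR r r' : tcat (inR r) (inR r') = inR (bmul D r r').
Proof.
by rewrite /tcat (tlift_inR (tcat_bal _)) (tlift_inR (gcat_balRr r)).
Qed.

Lemma tcat_RW r x s : tcat (inR r) (ten (x :: s)) = ten (src D r * x :: s).
Proof.
by rewrite /tcat (tlift_inR (tcat_bal _)) (tlift_ten (gcat_balRr r)).
Qed.

Lemma tcat_WR s x r : tcat (ten (rcons s x)) (inR r) =
  ten (rcons s (tgt D r * x)).
Proof.
rewrite -gcat_wordR; case E: (rcons s x) => [|a u]; first by case: s E.
by rewrite /tcat (tlift_ten (tcat_bal _)) (tlift_inR (gcat_balWr a u)).
Qed.

Lemma tcat1l : left_id (inR (bone D)) (@tcat _ _ _ D).
Proof.
apply: tpow_ext => [||r|x s]; [exact: tcat_linr|exact: linear_id| |].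
  by rewrite tcat_RR (ba_mul1 hB).
by rewrite tcat_RW (ba_src1 hB) mul1r.
Qed.

Lemma tcat1r : right_id (inR (bone D)) (@tcat _ _ _ D).
Proof.
apply: tpow_ext => [||r|x s]; [exact: tcat_linl|exact: linear_id| |].
  by rewrite tcat_RR (ba_1mul hB).
by rewrite lastI tcat_WR (ba_tgt1 hB) mul1r.
Qed.

Lemma tcat_ten s s' : tcat (ten s) (ten s') = ten (s ++ s').
Proof.
case: s => [|x s]; first exact: tcat1l.
case: s' => [|y s']; first by rewrite cats0; exact: tcat1r.
by rewrite /tcat (tlift_ten (tcat_bal _)) (tlift_ten (gcat_balWr x s)).
Qed.

(** On generators. A base element between two words is where balancedness
    enters, and a word of one letter between two base elements needs that
    source and target commute. *)
Lemma tcatA : associative (@tcat _ _ _ D).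
Proof.
move=> t u v; move: v.
apply: tpow_ext; [exact: (linear_comp (tcat_linr _) (tcat_linr _))
  | exact: tcat_linr| |].
all: move: u.
- move=> u r; move: u; apply: tpow_ext => [||a|x s].
  + exact: (linear_comp (tcat_linr t) (tcat_linl _)).
  + exact: (linear_comp (tcat_linl _) (tcat_linr t)).
  + move: t; apply: tpow_ext => [||b|x s]; [exact: tcat_linl|
      exact: (linear_comp (tcat_linl _) (tcat_linl _))| |].
      by rewrite !tcat_RR (ba_mulA hB).
    by rewrite lastI tcat_RR !tcat_WR (ba_tgtM hB) mulrA.
  + move: t; apply: tpow_ext => [||b|y u]; [exact: tcat_linl|
      exact: (linear_comp (tcat_linl _) (tcat_linl _))| |].
      case/lastP: s => [|s z].
        rewrite -[[:: x]]/(rcons [::] x) !tcat_WR !tcat_RW.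
        by rewrite -[[:: src D b * x]]/(rcons [::] _) tcat_WR !mulrA
          (ba_comm hB).
      by rewrite -rcons_cons tcat_WR !tcat_RW -!rcons_cons tcat_WR.
    by rewrite (lastI x s) tcat_WR !tcat_ten -!rcons_cat tcat_WR.
move=> u x s; move: u; apply: tpow_ext => [||a|y w].
+ exact: (linear_comp (tcat_linr t) (tcat_linl _)).
+ exact: (linear_comp (tcat_linl _) (tcat_linr t)).
+ move: t; apply: tpow_ext => [||b|y w]; [exact: tcat_linl|
    exact: (linear_comp (tcat_linl _) (tcat_linl _))| |].
    by rewrite tcat_RR !tcat_RW (ba_srcM hB) mulrA.
  by rewrite (lastI y w) tcat_WR tcat_RW !tcat_ten !cat_rcons (wbal_m tw).
+ move: t; apply: tpow_ext => [||b|z v]; [exact: tcat_linl|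
    exact: (linear_comp (tcat_linl _) (tcat_linl _))| |].
    by rewrite tcat_RW !tcat_ten !cat_cons tcat_RW.
  by rewrite !tcat_ten catA.
Qed.

Lemma ten_rcons s x : ten (rcons s x) = tcat (ten s) (inH x).
Proof. by rewrite tcat_ten cats1. Qed.

(** Tensors are built from the base by appending letters on the right. The
    recursive definitions below all follow this pattern, because iterated
    coproducts are defined by expanding the left factor. *)
Lemma tpow_ind (P : T -> Prop) :
  (forall c t u, P t -> P u -> P (c *: t + u)) ->
  (forall r, P (inR r)) -> (forall t x, P t -> P (tcat t (inH x))) ->
  forall t, P t.
Proof.
move=> PL PR Px t.
have P0 : P 0 by rewrite -(lin0 (@inR_linear _ _ _ D)); exact: PR.
have Pt s : P (ten s).
  elim/last_ind: s => [|s x IH]; first exact: PR.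
  by rewrite ten_rcons; exact: Px.
have [s [E _]] := presP t.2.
have -> : t = 1 *: inR t.1 + \sum_(p <- s) p.1 *: ten (p.2.1 :: p.2.2).
  rewrite scale1r {1}(tpow_eta t) E; congr (_ + _).
  rewrite (lin_comb (@snd_linear _ _ _ D)); apply: eq_bigr => -[c [x w]] _.
  by [].
apply: (PL _ _ _ (PR _)); elim: s {E} => [|p s IH];
  rewrite ?big_nil ?big_cons //.
exact: PL.
Qed.

(** The target map on the left factor and the source map on the right one both
    insert the same element of R between the factors. *)
Lemma tcat_balanced (f g : H -> T) :
  linear f -> linear g ->
  (forall r x, f (tgt D r * x) = tcat (f x) (inR r)) ->
  (forall r x, g (src D r * x) = tcat (inR r) (g x)) ->
  balanced (src D) (tgt D) (fun x y => tcat (f x) (g y)).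
Proof.
move=> fL gL fr gr; split=> [y|x|r x y].
- exact: (linear_comp (tcat_linl _) fL).
- exact: (linear_comp (tcat_linr _) gL).
- by rewrite fr gr tcatA.
Qed.
End TensorAlgebra.

(** * The action of H on tensor powers *)

Lemma hopf_base (K : fieldType) (R : lmodType K) (H : algType K)
  (D : hopf_data R H) : hopf_algebroid D -> base_axioms D.
Proof. by case. Qed.

Section ActionDef.
Variables (K : fieldType) (R : lmodType K) (H : algType K) (D : hopf_data R H).

(** The action on the word read backwards: the last letter is multiplied by the
    second factor of the coproduct. On the empty word it gives h |> 1, so that
    words of length one need no separate clause: they are covered by the counit
    axiom. *)
Fixpoint rev_act (h : H) (s : seq H) : tpow D :=
  if s is x :: s' then
    hlift (fun y z => tcat (rev_act y s') (inH D (z * x))) (comul D h)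
  else inR D (counit D h).

Definition act (h : H) (t : tpow D) : tpow D :=
  tlift (fun g => match g with
    | inl r => inR D (hact D h r)
    | inr s => rev_act h (rev s)
    end) t.

(** For t = x (x) y this is x . A (x) y . B; both the action on a product
    (t = Delta h) and the twisted product (t = F) have this form. *)
Definition pair_act (t : htens (src D) (tgt D)) (A B : tpow D) : tpow D :=
  hlift (fun y z => tcat (act y A) (act z B)) t.
End ActionDef.

Section Action.
Variables (K : fieldType) (R : lmodType K) (H : algType K) (D : hopf_data R H).
Hypothesis hD : hopf_algebroid D.
Let hB : base_axioms D := hopf_base hD.
Local Notation T := (tpow D).
Local Notation ten := (ten D).
Local Notation inR := (inR D).
Local Notation inH := (inH D).
Local Notation hpair := (hpair (src D) (tgt D)).
Local Notation balanced := (balanced (src D) (tgt D)).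

(** This is the axiom comul_bal; it makes Delta h . u independent of the lift
    of u. *)
Lemma hrmul_balanced h : balanced (hrmul (comul D h)).
Proof.
split=> [y|x|r x y]; [exact: hrmul_linl|exact: hrmul_linr|].
have := comul_bal hD h r => /eqP; rewrite subr_eq0 => /eqP e.
by rewrite -[y]mul1r -[X in hrmul _ (_ * _) X]mul1r mul1r -[in LHS](mul1r y)
  -hrmulM e hrmulM !mul1r.
Qed.

Lemma hmul_pair h x y : hmul (comul D h) (hpair x y) = hrmul (comul D h) x y.
Proof. exact/hlift_pair/hrmul_balanced. Qed.

Lemma hmul_linear h : linear (hmul (comul D h)).
Proof. exact/hlift_linear/hrmul_balanced. Qed.

Lemma comul_tgtr h r : comul D (h * tgt D r) = hrmul (comul D h) 1 (tgt D r).
Proof.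
rewrite (comulM hD) -[tgt D r]mulr1 (comul_tgt hD) (comul1 hD).
rewrite hlift_pair; first by rewrite hmul_pair mulr1.
have B := hpair_balanced (src D) (tgt D).
split=> [y|x|a x y]; first exact: (bal_l B).
  exact: (linear_comp (bal_r B x) (mulrr_linear _)).
by rewrite (bal_m B) !mulrA (ba_comm hB).
Qed.

(** The form in which comul_bal is used: an element of R moves across the two
    right factors of Delta h. *)
Lemma hlift_balr (V : lmodType K) (f : H -> H -> V) h r : balanced f ->
  hlift (fun x y => f (x * tgt D r) y) (comul D h) =
  hlift (fun x y => f x (y * src D r)) (comul D h).
Proof.
move=> fB; have := comul_bal hD h r => /eqP; rewrite subr_eq0 => /eqP e.
transitivity (hlift f (hrmul (comul D h) (tgt D r) 1)).
  by rewrite hlift_hrmul //; apply: eq_hlift => x y; rewrite mulr1.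
by rewrite e hlift_hrmul //; apply: eq_hlift => x y; rewrite mulr1.
Qed.

(** beta(r) - alpha(r) lies in the kernel of the counit, which is a left
    ideal. *)
Lemma counit_tgtr h r : counit D (h * tgt D r) = counit D (h * src D r).
Proof.
apply/eqP; rewrite -subr_eq0 -(linB (counit_lin hD)) -mulrBr; apply/eqP.
apply: (counit_ker hD); rewrite (linB (counit_lin hD)).
rewrite -[tgt D r]mulr1 -[src D r]mulr1 (counit_tgt hD) (counit_src hD).
by rewrite (counit1 hD) (ba_mul1 hB) (ba_1mul hB) subrr.
Qed.

Lemma hact_src h r a : hact D (src D r * h) a = bmul D r (hact D h a).
Proof. by rewrite /hact -mulrA (counit_src hD). Qed.

Lemma hact_tgt h r a : hact D (tgt D r * h) a = bmul D (hact D h a) r.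
Proof. by rewrite /hact -mulrA (counit_tgt hD). Qed.

Lemma hact_linl a : linear (fun h => hact D h a).
Proof. exact: (linear_comp (counit_lin hD) (mulrl_linear _)). Qed.

Lemma hact_linr h : linear (hact D h).
Proof.
apply: (linear_comp (counit_lin hD)).
exact: (linear_comp (mulrr_linear h) (src_lin hD)).
Qed.

(** k alpha(r) and alpha(k |> r) have the same counit, and the kernel of the
    counit is a left ideal. *)
Lemma hactM h k r : hact D (h * k) r = hact D h (hact D k r).
Proof.
apply/eqP; rewrite -subr_eq0 -(linB (counit_lin hD)) -mulrA -mulrBr; apply/eqP.
apply: (counit_ker hD); rewrite (linB (counit_lin hD)).
rewrite -[src D (hact D k r)]mulr1 (counit_src hD) (counit1 hD).
by rewrite (ba_1mul hB) subrr.
Qed.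

Lemma tcat_app_balanced (f : H -> T) x : linear f ->
  (forall r h, f (tgt D r * h) = tcat (f h) (inR r)) ->
  balanced (fun y z => tcat (f y) (inH (z * x))).
Proof.
move=> fL fr; apply: (tcat_balanced hB) => //.
  exact: (linear_comp (@inH_linear _ _ _ D) (mulrl_linear x)).
by move=> r z; rewrite (tcat_RW hB) mulrA.
Qed.

(** Linearity and the rule for the target map, for shorter words, are what makes
    the recursion well defined on the coproduct; hence the joint induction. *)
Lemma rev_act_props s : [/\ linear (fun h => rev_act D h s),
  forall r h, rev_act D (tgt D r * h) s = tcat (rev_act D h s) (inR r) &
  forall r h, rev_act D (src D r * h) s = tcat (inR r) (rev_act D h s)].
Proof.
elim: s => [|x s [IL It Is]] /=.
  split; first exact: (linear_comp (@inR_linear _ _ _ D) (counit_lin hD)).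
    by move=> r h; rewrite (counit_tgt hD) (tcat_RR hB).
  by move=> r h; rewrite (counit_src hD) (tcat_RR hB).
have B := tcat_app_balanced x IL It.
split.
- exact: (linear_comp (hlift_linear B) (comul_lin hD)).
- move=> r h; rewrite (comul_tgt hD) !(hlift_comp _ _ (hlift_linear B)).
  rewrite (hlift_comp _ _ (tcat_linl hB _)); apply: eq_hlift => y z.
  rewrite (hlift_pair B) -(tcatA hB); congr (tcat _ _).
  by rewrite (tcat_WR hB [::]) mulrA.
- move=> r h; rewrite (comul_src hD) !(hlift_comp _ _ (hlift_linear B)).
  rewrite (hlift_comp _ _ (tcat_linr hB _)); apply: eq_hlift => y z.
  by rewrite (hlift_pair B) Is (tcatA hB).
Qed.

Lemma rev_act_lin s : linear (fun h => rev_act D h s).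
Proof. by case: (rev_act_props s). Qed.

Lemma rev_act_tgt s r h : rev_act D (tgt D r * h) s =
  tcat (rev_act D h s) (inR r).
Proof. by case: (rev_act_props s). Qed.

Lemma rev_act_balanced s x :
  balanced (fun y z => tcat (rev_act D y s) (inH (z * x))).
Proof. exact: (tcat_app_balanced _ (rev_act_lin s) (rev_act_tgt s)). Qed.

Lemma rev_act_wlin h s1 s2 : linear (fun x => rev_act D h (s1 ++ x :: s2)).
Proof.
elim: s1 h => [|a s1 IH] h /=; apply: hlift_param => y z; last first.
  exact: (linear_comp (tcat_linl hB _) (IH y)).
apply: (linear_comp (tcat_linr hB _)).
exact: (linear_comp (@inH_linear _ _ _ D) (mulrr_linear z)).
Qed.

Lemma rev_act_tgtr h r x s :
  rev_act D (h * tgt D r) (x :: s) = rev_act D h (tgt D r * x :: s).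
Proof.
rewrite /= comul_tgtr hlift_hrmul; last exact: rev_act_balanced.
by apply: eq_hlift => y z; rewrite mulr1 mulrA.
Qed.

(** Moving r across the last two letters amounts to moving it across the two
    factors of Delta h. *)
Lemma rev_act_wbal h r x y s1 s2 :
  rev_act D h (s1 ++ [:: y, tgt D r * x & s2]) =
  rev_act D h (s1 ++ [:: src D r * y, x & s2]).
Proof.
elim: s1 h => [|a s1 IH] h; last by rewrite /=; apply: eq_hlift => u v;
  rewrite IH.
pose f u v := tcat (rev_act D u (x :: s2)) (inH (v * y)).
have fB : balanced f := rev_act_balanced (x :: s2) y.
rewrite [RHS](_ : _ = hlift (fun u v => f u (v * src D r)) (comul D h)).
  rewrite -(hlift_balr _ _ fB); apply: eq_hlift => u v.
  by rewrite /f rev_act_tgtr.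
by apply: eq_hlift => u v; rewrite /f mulrA.
Qed.

Let actB h : gen_balanced D (fun g => match g with
    | inl r => inR (hact D h r) | inr s => rev_act D h (rev s) end).
Proof.
split; first exact: (linear_comp (@inR_linear _ _ _ D) (hact_linr h)).
split=> [s1 s2|r x y s1 s2].
  by move=> c x y; rewrite !rev_cat !rev_cons -!cats1 -!catA;
    apply: rev_act_wlin.
by rewrite !rev_cat !rev_cons -!cats1 -!catA; apply: rev_act_wbal.
Qed.

Lemma act_linr h : linear (act h : T -> T).
Proof. exact: tlift_linear. Qed.

Lemma act_linl t : linear (fun h => act h t : T).
Proof.
apply: tlift_param => [r|x s]; last exact: rev_act_lin.
exact: (linear_comp (@inR_linear _ _ _ D) (hact_linl r)).
Qed.

Lemma act_inR h r : act h (inR r) = inR (hact D h r).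
Proof. exact: tlift_inR. Qed.

Lemma act_ten h s : act h (ten s) = rev_act D h (rev s).
Proof.
case: s => [|x s]; last by rewrite /act tlift_ten.
by rewrite /= act_inR /hact (src1 hD) mulr1.
Qed.

Lemma act_tgt r h (t : T) : act (tgt D r * h) t = tcat (act h t) (inR r).
Proof.
move: t; apply: tpow_ext => [||a|x s].
- exact: act_linr.
- exact: (linear_comp (tcat_linl hB _) (act_linr h)).
- by rewrite !act_inR hact_tgt (tcat_RR hB).
- by rewrite !act_ten; apply: rev_act_tgt.
Qed.

Lemma act_src r h t : act (src D r * h) t = tcat (inR r) (act h t).
Proof.
move: t; apply: tpow_ext => [||a|x s].
- exact: act_linr.
- exact: (linear_comp (tcat_linr hB _) (act_linr h)).
- by rewrite !act_inR hact_src (tcat_RR hB).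
- by rewrite !act_ten; case: (rev_act_props (rev (x :: s))).
Qed.

Lemma act_app_balanced t x : balanced (fun y z => tcat (act y t) (inH (z * x))).
Proof. exact: (tcat_app_balanced _ (act_linl t) (fun r h => act_tgt r h t)).
  Qed.

(** The recursion of rev_act, now for arbitrary tensors. The case of a base
    element is not an instance of the recursion: alpha(r) x is a word of length
    one, and r has to be moved from z to y, where it disappears in the
    counit. *)
Lemma act_app h t x : act h (tcat t (inH x)) =
  hlift (fun y z => tcat (act y t) (inH (z * x))) (comul D h).
Proof.
move: t; apply: tpow_ext => [||r|y s].
- exact: (linear_comp (act_linr h) (tcat_linl hB _)).
- by apply: hlift_param => y z;
  exact: (linear_comp (tcat_linl hB _) (act_linr y)).
- rewrite (tcat_RW hB) act_ten /=.
  pose f u v := tcat (inR (counit D u)) (inH (v * x)).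
  have fB : balanced f := rev_act_balanced [::] x.
  rewrite [LHS](_ : _ = hlift (fun u v => f u (v * src D r)) (comul D h)).
    rewrite -(hlift_balr _ _ fB); apply: eq_hlift => u v.
    by rewrite /f act_inR counit_tgtr.
  by apply: eq_hlift => u v; rewrite /f mulrA.
- rewrite -(ten_rcons hB) act_ten rev_rcons; apply: eq_hlift => u v.
  by rewrite act_ten.
Qed.

(** This is the left counit axiom. *)
Lemma act_inH h x : act h (inH x) = inH (h * x).
Proof.
rewrite act_ten /= -[in RHS](counitL hD h)
  [in RHS](hlift_comp _ _ (mulrl_linear x)).
rewrite (hlift_comp _ _ (@inH_linear _ _ _ D)).
by apply: eq_hlift => y z; rewrite (tcat_RW hB) mulrA.
Qed.

Lemma act1 (t : T) : act 1 t = t.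
Proof.
elim/(tpow_ind hB): t => [c t u Et Eu|r|t x E].
- by rewrite act_linr Et Eu.
- rewrite act_inR /hact mul1r -[src D r]mulr1 (counit_src hD) (counit1 hD).
  by rewrite (ba_1mul hB).
- by rewrite act_app (comul1 hD) (hlift_pair (act_app_balanced t x)) E mul1r.
Qed.

(** Multiplicativity of the coproduct, by induction on the length. *)
Lemma actM h k (t : T) : act (h * k) t = act h (act k t).
Proof.
elim/(tpow_ind hB): t h k => [c t u Et Eu|r|t x E] h k.
- by rewrite !act_linr Et Eu.
- by rewrite !act_inR hactM.
have B := act_app_balanced t x.
rewrite act_app (comulM hD) (hlift_comp _ _ (hlift_linear B)).
rewrite act_app (hlift_comp _ _ (act_linr h)); apply: eq_hlift => a b.
rewrite act_app hlift_hrmul //; apply: eq_hlift => y z.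
by rewrite E mulrA.
Qed.

Lemma act_tgt1 r (t : T) : act (tgt D r) t = tcat t (inR r).
Proof. by rewrite -[tgt D r]mulr1 act_tgt act1. Qed.

Lemma act_src1 r (t : T) : act (src D r) t = tcat (inR r) t.
Proof. by rewrite -[src D r]mulr1 act_src act1. Qed.

Lemma act_scalar c (t : T) : act c%:A t = c *: t.
Proof. by rewrite (linZ (act_linl t)) act1. Qed.

Lemma pair_act_balanced (A B : T) :
  balanced (fun y z => tcat (act y A) (act z B)).
Proof.
apply: (tcat_balanced hB); try exact: act_linl.
- by move=> r x; rewrite act_tgt.
- by move=> r x; rewrite act_src.
Qed.

Lemma pair_act_lin (A B : T) : linear (fun t => pair_act t A B).
Proof. exact/hlift_linear/pair_act_balanced. Qed.

Lemma pair_act_linl t (B : T) : linear (fun A => pair_act t A B).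
Proof.
by apply: hlift_param => y z;
  exact: (linear_comp (tcat_linl hB _) (act_linr y)).
Qed.

Lemma pair_act_linr t (A : T) : linear (fun B => pair_act t A B).
Proof.
by apply: hlift_param => y z;
  exact: (linear_comp (tcat_linr hB _) (act_linr z)).
Qed.

Lemma pair_act_pair x y (A B : T) : pair_act (hpair x y) A B =
  tcat (act x A) (act y B).
Proof. exact/hlift_pair/pair_act_balanced. Qed.

Lemma pair_act_hrmul t x y (A B : T) :
  pair_act (hrmul t x y) A B = pair_act t (act x A) (act y B).
Proof.
rewrite /pair_act hlift_hrmul; last exact: pair_act_balanced.
by apply: eq_hlift => u v; rewrite !actM.
Qed.

(** A linear map on T that evaluates a trilinear balanced function on tensors
    of length three. It turns the coassociativity and cocycle equations, which
    live in T, into identities for actions on triples of tensors. *)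
Definition triple_act (A B C : T) (t : T) : T :=
  tlift (fun g : gen R H => if g is inr [:: x; y; z] then
    tcat (tcat (act x A) (act y B)) (act z C) else 0) t.

Lemma triple_act_balanced (A B C : T) : gen_balanced D (fun g : gen R H =>
  if g is inr [:: x; y; z] then tcat (tcat (act x A) (act y B)) (act z C) else
    0).
Proof.
have L1 := fun u => tcat_linl hB u; have L2 := fun u => tcat_linr hB u.
split; first exact: linear_zero.
split.
  case=> [|a [|b [|c s1]]]; last by move=> s2 k x y; case: s1 => *;
    rewrite scaler0 addr0.
  - case=> [|b [|c [|d s2]]]; try by move=> k x y; rewrite scaler0 addr0.
    exact: (linear_comp (L1 _) (linear_comp (L1 _) (act_linl A))).
  - case=> [|b [|c s2]]; try by move=> k x y; rewrite scaler0 addr0.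
    exact: (linear_comp (L1 _) (linear_comp (L2 _) (act_linl B))).
  - case=> [|c s2]; last by move=> k x y; rewrite scaler0 addr0.
    exact: (linear_comp (L2 _) (act_linl C)).
move=> r x y [|a [|b [|c s1]]] s2.
- case: s2 => [|b [|c s2]]; [by []| |by []].
  by rewrite /= act_tgt act_src !(tcatA hB).
- case: s2 => [|c s2]; [|by []].
  by rewrite /= act_tgt act_src !(tcatA hB).
- by [].
- by case: s1.
Qed.

Lemma triple_act_linear A B C : linear (triple_act A B C).
Proof. exact/tlift_linear/triple_act_balanced. Qed.

Lemma triple_act_emb2l A B C t z :
  triple_act A B C (tcat (emb2 t) (inH z)) = tcat (pair_act t A B) (act z C).
Proof.
move: t; apply: htens_ext => [||x y].
- apply: (linear_comp (triple_act_linear A B C)).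
  exact: (linear_comp (tcat_linl hB _) (@emb2_linear _ _ _ D)).
- exact: (linear_comp (tcat_linl hB _) (pair_act_lin A B)).
by rewrite emb2_pair (tcat_ten hB) pair_act_pair /triple_act
  (tlift_ten (triple_act_balanced A B C)).
Qed.

Lemma triple_act_emb2r A B C t x :
  triple_act A B C (tcat (inH x) (emb2 t)) = tcat (act x A) (pair_act t B C).
Proof.
move: t; apply: htens_ext => [||y z].
- apply: (linear_comp (triple_act_linear A B C)).
  exact: (linear_comp (tcat_linr hB _) (@emb2_linear _ _ _ D)).
- exact: (linear_comp (tcat_linr hB _) (pair_act_lin B C)).
rewrite emb2_pair (tcat_ten hB) pair_act_pair /triple_act
  (tlift_ten (triple_act_balanced A B C)).
by rewrite (tcatA hB).
Qed.

(** For B of length one this is act_app; longer B follow by coassociativity,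
    and for B in R the claim is the right counit axiom applied to h beta(r). *)
Lemma act_tcat h A B : act h (tcat A B) = pair_act (comul D h) A B.
Proof.
elim/(tpow_ind hB): B h A => [c t u Et Eu|r|B x E] h A.
- by rewrite (tcat_linr hB) act_linr Et Eu pair_act_linr.
(* h beta(r) is expanded by the right counit axiom. *)
- rewrite -act_tgt1 -actM -{1}(counitR hD (h * _)) comul_tgtr.
  rewrite (hlift_hrmul _ _ _ ); last first.
    split=> [y|x|a x y].
    + exact: mulrr_linear.
    + apply: (linear_comp (mulrl_linear x)).
      exact: (linear_comp (tgt_lin hD) (counit_lin hD)).
    + by rewrite (counit_src hD) (tgtM hD) mulrA.
  rewrite (hlift_comp _ _ (act_linl A)); apply: eq_hlift => y z.
  by rewrite act_tgt mulr1 act_inR counit_tgtr.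
have L := triple_act_linear A B (inH x).
(* Coassociativity, applied to the triple A, B, x. *)
have := congr1 (triple_act A B (inH x)) (comulA hD h).
rewrite !(hlift_comp _ _ L).
rewrite (tcatA hB) act_app => C3.
transitivity (hlift (fun y z => triple_act A B (inH x)
  (tcat (emb2 (comul D y)) (inH z)))
    (comul D h)).
  by apply: eq_hlift => y z; rewrite triple_act_emb2l -E act_inH.
rewrite C3; apply: eq_hlift => y z; rewrite triple_act_emb2r; congr (tcat _ _).
rewrite act_app; apply: eq_hlift => u v; by rewrite act_inH.
Qed.

(** The product with Delta h is factorwise, and by act_tcat Delta h distributes
    the action of h over a product. *)
Lemma pair_act_hmul h u A B :
  pair_act (hmul (comul D h) u) A B = act h (pair_act u A B).
Proof.
move: u; apply: htens_ext => [||x y].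
- exact: (linear_comp (pair_act_lin A B) (hmul_linear h)).
- exact: (linear_comp (act_linr h) (pair_act_lin A B)).
by rewrite hmul_pair pair_act_hrmul pair_act_pair act_tcat.
Qed.
End Action.

(** * The product defined by a twistor *)

Section TwistedProduct.
Variables (K : fieldType) (R : lmodType K) (H : algType K) (D : hopf_data R H).
Variable F : htens (src D) (tgt D).
Hypothesis hD : hopf_algebroid D.
Hypothesis hF : twistor F.
Let hB : base_axioms D := hopf_base hD.
Local Notation T := (tpow D).
Local Notation inR := (inR D).
Local Notation inH := (inH D).
Local Notation e := (inR (bone D)).

Definition twcat (A B : T) : T := pair_act F A B.
Local Notation "A ** B" := (twcat A B) (at level 40, left associativity).

Lemma twcat_linl B : linear (fun A => A ** B).
Proof. exact: pair_act_linl. Qed.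

Lemma twcat_linr A : linear (fun B => A ** B).
Proof. exact: pair_act_linr. Qed.

Lemma act_twcat h A B : act h (A ** B) = pair_act (hmul (comul D h) F) A B.
Proof. by rewrite pair_act_hmul. Qed.

(** Both sides apply the two sides of the cocycle equation to the triple
    A, B, C. *)
Lemma twcatA : associative twcat.
Proof.
move=> A B C; have L := triple_act_linear hD A B C.
have /(congr1 (triple_act A B C)) := tw_cocycle hF;
  rewrite !(hlift_comp _ _ L) => E.
transitivity (hlift (fun x y =>
    triple_act A B C (tcat (inH x) (emb2 (hmul (comul D y) F)))) F).
  by apply: eq_hlift => x y; rewrite triple_act_emb2r // act_twcat.
by rewrite -E; apply: eq_hlift => x y; rewrite triple_act_emb2l // act_twcat.
Qed.

Lemma twcat_inRl a B : inR a ** B = act (twsrc F a) B.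
Proof.
rewrite /twsrc (hlift_comp _ _ (act_linl hD B)); apply: eq_hlift => x y.
by rewrite act_inR // act_src.
Qed.

Lemma twcat_inRr a A : A ** inR a = act (twtgt F a) A.
Proof.
rewrite /twtgt (hlift_comp _ _ (act_linl hD A)); apply: eq_hlift => x y.
by rewrite act_inR // act_tgt.
Qed.

Lemma twcat1l : left_id e twcat.
Proof.
move=> B; rewrite twcat_inRl -[RHS](act1 hD) -(tw_counitL hF).
by congr act; apply: eq_hlift => x y; rewrite /hact (src1 hD) mulr1.
Qed.

Lemma twcat1r : right_id e twcat.
Proof.
move=> A; rewrite twcat_inRr -[RHS](act1 hD) -(tw_counitR hF).
by congr act; apply: eq_hlift => x y; rewrite /hact (src1 hD) mulr1.
Qed.

Lemma twcat_RR a b : inR a ** inR b = inR (twmul F a b).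
Proof.
rewrite /twmul (hlift_comp _ _ (@inR_linear _ _ _ D)); apply: eq_hlift => x y.
by rewrite !act_inR // tcat_RR.
Qed.

Lemma twcat_RH a x : inR a ** inH x = inH (twsrc F a * x).
Proof. by rewrite twcat_inRl act_inH. Qed.

Lemma twcat_HR x a : inH x ** inR a = inH (twtgt F a * x).
Proof. by rewrite twcat_inRr act_inH. Qed.

Lemma twcat_HRH x r y : inH (twtgt F r * x) ** inH y =
  inH x ** inH (twsrc F r * y).
Proof. by rewrite -twcat_HR -twcat_RH twcatA. Qed.

(** Each axiom is the associativity or unitality of the twisted product in
    degrees zero and one, where inR and inH are injective. *)
Lemma twist_base : base_axioms (twist F).
Proof.
have iR : linear inR := @inR_linear _ _ _ D.
have iH : linear inH := @inH_linear _ _ _ D.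
have jR := @inR_inj _ _ _ D.
have jH := @inH_inj _ _ _ D.
have sE a : inH (twsrc F a) = inR a ** inH 1 by rewrite twcat_RH mulr1.
have tE a : inH (twtgt F a) = inH 1 ** inR a by rewrite twcat_HR mulr1.
split=> /=.
- by move=> b c x y; apply: jR; rewrite iR -!twcat_RR iR twcat_linl.
- by move=> b c x y; apply: jR; rewrite iR -!twcat_RR iR twcat_linr.
- by move=> a b c; apply: jR; rewrite -!twcat_RR twcatA.
- by move=> a; apply: jR; rewrite -twcat_RR twcat1l.
- by move=> a; apply: jR; rewrite -twcat_RR twcat1r.
- by move=> c x y; apply: jH; rewrite iH !sE iR twcat_linl.
- by apply: jH; rewrite sE twcat1l.
- by move=> a b; apply: jH; rewrite sE -twcat_RR -twcatA !twcat_RH mulr1.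
- by move=> c x y; apply: jH; rewrite iH !tE iR twcat_linr.
- by apply: jH; rewrite tE twcat1r.
- by move=> a b; apply: jH; rewrite tE -twcat_RR twcatA !twcat_HR mulr1.
- by move=> a b; apply: jH; rewrite -twcat_RH -twcat_HR sE tE twcatA.
Qed.

Lemma pair_act_twsharp (t : htens (twsrc F) (twtgt F)) A B :
  pair_act (twsharp (M := H^o) (N := H^o) t) A B =
  hlift (fun x y => act x A ** act y B) t.
Proof.
rewrite /twsharp (plift_comp _ _ (pair_act_lin hD A B)) /hlift;
  congr (plift _ t).
apply: funext => -[x y]; exact: (pair_act_hrmul hD F x y A B).
Qed.

(** Invertibility of F^sharp on H (x) H, so that the default value is not
    taken. *)
Lemma twsharp_twcomul h :
  twsharp (M := H^o) (N := H^o) (twcomul F h) = hmul (comul D h) F.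
Proof.
have [g _ gK] := tw_inv hF H^o H^o.
rewrite /twcomul; case: xgetP => [t _ //|].
by move=> /(_ (g (hmul (comul D h) F))); case; apply: gK.
Qed.

(** The coproduct of the twist describes the action of H on twisted products
    just as the original one does on tensor products. This is what makes the
    comparison map H-linear. *)
Lemma act_twcat_twcomul h A B :
  act h (A ** B) = hlift (fun x y => act x A ** act y B) (twcomul F h).
Proof. by rewrite act_twcat -twsharp_twcomul pair_act_twsharp. Qed.
End TwistedProduct.

(** * The grading *)

Section Grading.
Variables (K : fieldType) (R : lmodType K) (H : algType K) (D : hopf_data R H).
Local Notation T := (tpow D).
Local Notation ten := (ten D).
Local Notation inR := (inR D).
Local Notation inH := (inH D).

(** The projection onto the components whose degrees satisfy P. With P a
    singleton it detects homogeneous elements, with P a parity it gives signs,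
    and with P an initial segment it truncates. *)
Definition degpart (P : pred nat) (t : T) : T :=
  tlift (fun g => if P (gdeg g) then gval D g else 0) t.

Lemma degpart_balanced P :
  gen_balanced D (fun g => if P (gdeg g) then gval D g else 0).
Proof.
split=> /=; first by case: (P 0%N); [exact: inR_linear|exact: linear_zero].
have E s1 s2 (x y : H) : size (s1 ++ x :: s2) = size (s1 ++ y :: s2).
  by rewrite !size_cat.
split=> [s1 s2 c x y|r x y s1 s2] /=.
  rewrite (E s1 s2 x (c *: x + y)) (E s1 s2 y (c *: x + y)).
  by case: (P _); rewrite ?(wbal_l (ten_word_balanced D)) ?scaler0 ?addr0.
by rewrite !size_cat; case: (P _); rewrite ?(wbal_m (ten_word_balanced D)).
Qed.

Lemma degpart_linear P : linear (degpart P).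
Proof. exact/tlift_linear/degpart_balanced. Qed.

Lemma degpart_inR P r : degpart P (inR r) = if P 0%N then inR r else 0.
Proof. exact: (tlift_inR (degpart_balanced P)). Qed.

Lemma degpart_ten P s : degpart P (ten s) = if P (size s) then ten s else 0.
Proof.
by case: s => [|x s]; [exact:
  degpart_inR | exact: (tlift_ten (degpart_balanced P))].
Qed.

Lemma eq_degpart P Q t : P =1 Q -> degpart P t = degpart Q t.
Proof. by move=> /funext ->. Qed.

Lemma tlift_closed (V : lmodType K) (Q : V -> Prop) (f : gen R H -> V) (t : T) :
  Q 0 -> (forall c u v, Q u -> Q v -> Q (c *: u + v)) ->
  (forall r, Q (f (inl r))) -> (forall x s, Q (f (inr (x :: s)))) ->
  Q (tlift f t).
Proof.
move=> Q0 QL Q1 Q2; have [s [_ E]] := presP t.2; rewrite /tlift E.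
rewrite -[f (inl _)]scale1r; apply: (QL) => //.
elim: s {E} => [|[c [x w]] s IH]; rewrite ?big_nil ?big_cons //.
exact: QL.
Qed.

Lemma homog_comb n c (t u : T) : homog n t -> homog n u -> homog n (c *: t + u).
Proof.
case: n => [|m] /=; first by move=> /= -> ->; rewrite scaler0 addr0.
move=> [-> [v hv ->]] [-> [w hw ->]]; split; first by rewrite scaler0 addr0.
exists (c *: v + w); last by rewrite prescl_linear.
move=> x; rewrite mem_dom coeffD coeffZ => hx.
case vx: (x \in dom v); first exact: hv.
case wx: (x \in dom w); first exact: hw.
by move: hx; rewrite !coeff_outdom ?vx ?wx // mulr0 addr0 eqxx.
Qed.

Lemma homog0 n : homog n (0 : T).
Proof.
case: n => [|n] //=; split=> //; exists 0; first by move=> w; rewrite dom0.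
by rewrite (lin0 (@prescl_linear _ _ _)).
Qed.

(** Reduces homogeneity, which mentions representatives, to an equation that
    linear maps transport. *)
Lemma homogP n (t : T) : homog n t <-> degpart (pred1 n) t = t.
Proof.
split=> [|<-]; last first.
  apply: tlift_closed => [|c u v|r|x s] /=;
    [exact: homog0|exact: homog_comb| |].
    by case: eqP => [<-|_] //; exact: homog0.
  case: eqP => [<-|_]; last exact: homog0.
  split=> //; exists << (x, s) >> => // w; rewrite domU1 inE => /eqP -> //.
case: n => [|m] /=.
  move=> t2; rewrite (tpow_eta t) t2 -[(0, 0)]/(0 : T) addr0.
  by rewrite degpart_inR.
case=> t1 [v hv t2]; rewrite (tpow_eta t) t1 t2 (lin0 (@inR_linear _ _ _ _))
  add0r.
rewrite -(freeg_sumE v) (lin_sum (@prescl_linear _ _ _)).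
rewrite (lin_sum (@snd_linear _ _ _ D)) (lin_sum (degpart_linear _)).
rewrite big_seq [RHS]big_seq; apply: eq_bigr => -[x s] /hv /= sm.
have -> : << coeff (x, s) v *g (x, s) >> =
    coeff (x, s) v *: << (x, s) >> :> {freeg (H * seq H) / K}.
  by apply/eqP/freeg_eqP => y; rewrite coeffZ !coeffU mul1r.
rewrite (linZ (@prescl_linear _ _ _)) (linZ (@snd_linear _ _ _ D)).
rewrite (linZ (degpart_linear _)); congr (_ *: _).
by rewrite -[(0, _)]/(ten (x :: s)) degpart_ten /= sm eqxx.
Qed.

(** The automorphism (-1)^n in degree n. Writing signs with it keeps the
    operations multilinear on inhomogeneous tensors. *)
Definition sgn (t : T) : T := degpart (predC odd) t - degpart odd t.

Lemma sgn_linear : linear sgn.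
Proof.
apply: linear_add; [|apply: linear_opp]; exact: degpart_linear.
Qed.

Definition graded n (t : T) := forall P : pred nat, degpart P t =
  if P n then t else 0.

Lemma graded_inR r : graded 0 (inR r).
Proof. by move=> P; rewrite degpart_inR. Qed.

Lemma graded_ten s : graded (size s) (ten s).
Proof. by move=> P; rewrite degpart_ten. Qed.

Lemma graded_gval g : graded (gdeg g) (gval D g).
Proof. by case: g => [r|s]; [exact: graded_inR|exact: graded_ten]. Qed.

Lemma graded_sgn n t : graded n t -> sgn t = (-1) ^+ n *: t.
Proof.
move=> tn; rewrite /sgn !tn /= -signr_odd.
by case: (odd n); rewrite ?expr0 ?expr1 ?scaleN1r ?scale1r ?subr0 ?sub0r.
Qed.

Lemma degpart_split t : degpart odd t + degpart (predC odd) t = t.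
Proof.
move: t; apply: tpow_ext => [||r|x s].
- by apply: linear_add; apply: degpart_linear.
- exact: linear_id.
- by rewrite !degpart_inR /= add0r.
- by rewrite !degpart_ten /=; case: (odd _); rewrite /= ?addr0 ?add0r.
Qed.

Lemma sgnK t : sgn (sgn t) = t.
Proof.
have sL := sgn_linear.
move: t; apply: tpow_ext => [||r|x s].
- exact: linear_comp.
- exact: linear_id.
- by rewrite !(graded_sgn (graded_inR r)) !expr0 !scale1r
  (graded_sgn (graded_inR r)) expr0 scale1r.
- rewrite (graded_sgn (graded_ten (x :: s))) (linZ sL).
  by rewrite (graded_sgn (graded_ten (x :: s))) scalerA -expr2 sqrr_sign
    scale1r.
Qed.

Lemma degpart_false t : degpart (fun k => (k < 0)%N) t = 0.
Proof. by apply: (tlift_eval (G := fun=> 0)) => //; exact: linear_zero. Qed.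

Section Products.
Hypothesis hB : base_axioms D.

Lemma degpart_app P t x :
  degpart P (tcat t (inH x)) = tcat (degpart (fun n => P n.+1) t) (inH x).
Proof.
move: t; apply: tpow_ext => [||r|y s].
- exact: (linear_comp (degpart_linear _) (tcat_linl hB _)).
- exact: (linear_comp (tcat_linl hB _) (degpart_linear _)).
- rewrite (tcat_RW hB) degpart_ten degpart_inR.
  by rewrite -[size _]/1%N; case: (P 1%N); rewrite ?(tcat0l hB) // (tcat_RW hB).
- rewrite -(ten_rcons hB) !degpart_ten size_rcons.
  by case: (P _); rewrite ?(ten_rcons hB) ?(tcat0l hB).
Qed.

Lemma sgn_app t x : sgn (tcat t (inH x)) = - tcat (sgn t) (inH x).
Proof.
have E : degpart (fun n => predC odd n.+1) t = degpart odd t.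
  by apply: eq_degpart => n /=; rewrite negbK.
by rewrite /sgn !degpart_app (linB (tcat_linl hB _)) opprB E.
Qed.

Lemma degpart_bound t :
  exists n, forall m, (n <= m)%N -> degpart (fun k => (k < m)%N) t = t.
Proof.
elim/(tpow_ind hB): t => [c t u [n En] [n' En']|r|t x [n En]].
- exists (maxn n n') => m; rewrite geq_max => /andP[nm nm'].
  by rewrite degpart_linear En // En'.
- by exists 1%N => m m0; rewrite degpart_inR m0.
- by exists n.+1 => -[|m] // nm; rewrite degpart_app En.
Qed.
End Products.

Section HopfGrading.
Hypothesis hD : hopf_algebroid D.
Let hB : base_axioms D := hopf_base hD.

Lemma degpart_act P h t : degpart P (act h t) = act h (degpart P t).
Proof.
elim/(tpow_ind hB): t P h => [c t u Et Eu|r|t x E] P h.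
- by rewrite (act_linr hD) !degpart_linear (act_linr hD) Et Eu.
- rewrite (act_inR hD) !degpart_inR.
  by case: (P _); [rewrite (act_inR hD) | rewrite (lin0 (act_linr hD h))].
- rewrite (act_app hD) (degpart_app hB) (act_app hD).
  rewrite (hlift_comp _ _ (degpart_linear P)); apply: eq_hlift => y z.
  by rewrite (degpart_app hB) E.
Qed.

Lemma sgn_act h t : sgn (act h t) = act h (sgn t).
Proof. by rewrite /sgn !degpart_act (linB (act_linr hD h)). Qed.

Lemma sgn_tcat t u : sgn (tcat t u) = tcat (sgn t) (sgn u).
Proof.
elim/(tpow_ind hB): u => [c u v Eu Ev|r|u x E].
- by rewrite (tcat_linr hB) !sgn_linear (tcat_linr hB) Eu Ev.
- rewrite -(act_tgt1 hD) sgn_act (act_tgt1 hD) (graded_sgn (graded_inR r)).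
  by rewrite expr0 scale1r.
- rewrite (tcatA hB) !(sgn_app hB) E (linN (tcat_linr hB _)).
  by rewrite (tcatA hB).
Qed.

Variable F : htens (src D) (tgt D).

Lemma sgn_twcat t u : sgn (twcat F t u) = twcat F (sgn t) (sgn u).
Proof.
rewrite (hlift_comp _ _ sgn_linear); apply: eq_hlift => x y.
by rewrite sgn_tcat !sgn_act.
Qed.

Lemma degpart_twcat_app P t x :
  degpart P (twcat F t (inH x)) = twcat F (degpart (fun n => P n.+1) t) (inH x).
Proof.
rewrite (hlift_comp _ _ (degpart_linear P)); apply: eq_hlift => y z.
by rewrite !(act_inH hD) (degpart_app hB) degpart_act.
Qed.

Lemma graded_twcat_app n t x : graded n t -> graded n.+1 (twcat F t (inH x)).
Proof.
move=> tn P; rewrite degpart_twcat_app tn; case: (P _) => //.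
by rewrite (lin0 (twcat_linl F hD _)).
Qed.
End HopfGrading.
End Grading.

(** * Sums over strictly increasing positions *)

Section InsertionSums.
Variables (K : fieldType) (A : lmodType K) (op : A -> A -> A) (e : A).
Hypotheses (opA : associative op) (op1l : left_id e op) (op1r : right_id e op).
Hypotheses (op_linl : forall v, linear (fun u => op u v))
           (op_linr : forall u, linear (op u)).
Variables (q : nat -> nat) (c : nat -> A) (d : nat -> nat -> A).

Definition increasing p k (j : {ffun 'I_k -> 'I_p}) :=
  [forall l : 'I_k, forall l' : 'I_k, (l < l')%N ==> (j l < j l')%N].

Definition insertion_sign p k (j : {ffun 'I_k -> 'I_p}) : nat :=
  (\sum_(l < k) (j l - l + \sum_(l' < k | (l' < l)%N) q l') * (q l).+1)%N.

Definition insertion_prod p k (j : {ffun 'I_k -> 'I_p}) : A :=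
  \big[op/e]_(i < p) (if [pick l | j l == i] is Some l then d i l else c i).

(** The sum that defines braces, for an abstract associative product: c i stands
    for the i-th factor left alone and d i l for the l-th argument (of degree
    q l) inserted there. It is needed for two products, (x) and its twisted
    version. *)
Definition insertion_sum p k : A :=
  \sum_(j : {ffun 'I_k -> 'I_p} | increasing j) (-1) ^+ insertion_sign j *:
    insertion_prod j.

Lemma increasingP p k (j : {ffun 'I_k -> 'I_p}) :
  reflect (forall l l' : 'I_k, (l < l')%N -> (j l < j l')%N) (increasing j).
Proof.
apply: (iffP forallP) => [h l l' ll'|h l].
  by move/forallP: (h l) => /(_ l') /implyP; apply.
by apply/forallP => l'; apply/implyP; exact: h.
Qed.

Let big_op_recr p (f : 'I_p.+1 -> A) : \big[op/e]_i f i =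
  op (\big[op/e]_(i < p) f (widen_ord (leqnSn p) i)) (f ord_max).
Proof.
pose M := Monoid.isLaw.Build A e op opA op1l op1r.
pose opM : Monoid.law e := HB.pack op M.
exact: (@big_ord_recr _ _ opM).
Qed.

Definition widenf p k (j : {ffun 'I_k -> 'I_p}) : {ffun 'I_k -> 'I_p.+1} :=
  [ffun l => widen_ord (leqnSn p) (j l)].

Definition extendf p k (j : {ffun 'I_k -> 'I_p}) : {ffun 'I_k.+1 -> 'I_p.+1} :=
  [ffun l => if unlift ord_max l is Some l' then widen_ord (leqnSn p) (j l')
             else ord_max].

Lemma widen_lift n (i : 'I_n) : widen_ord (leqnSn n) i = fintype.lift ord_max i.
Proof. by apply: val_inj; rewrite /= /bump leqNgt ltn_ord. Qed.

Lemma extendf_widen p k (j : {ffun 'I_k -> 'I_p}) l :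
  extendf j (widen_ord (leqnSn k) l) = widen_ord (leqnSn p) (j l).
Proof. by rewrite ffunE widen_lift liftK. Qed.

Lemma extendf_max p k (j : {ffun 'I_k -> 'I_p}) : extendf j ord_max = ord_max.
Proof. by rewrite ffunE unlift_none. Qed.

Lemma widen_inj n : injective (widen_ord (leqnSn n)).
Proof. by move=> i i' /(congr1 val) ii; apply: val_inj. Qed.

Lemma ord_recr n (l : 'I_n.+1) :
  l = ord_max \/ exists l', l = widen_ord (leqnSn n) l'.
Proof.
case: (unliftP ord_max l) => [l' ->|->]; last by left.
by right; exists l'; rewrite widen_lift.
Qed.

Lemma insertion_sum_miss p k : \sum_(j : {ffun 'I_k -> 'I_p.+1} |
    increasing j && ~~ [exists l, j l == ord_max]) (-1) ^+ insertion_sign j *: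
      insertion_prod j =
  op (insertion_sum p k) (c p).
Proof.
transitivity (\sum_(j in @widenf p k @: [set j | increasing j])
    (-1) ^+ insertion_sign j *: insertion_prod j).
  apply: eq_bigl => j; apply/andP/imsetP => [[/increasingP ij nj]|[j' + ->]].
    have jp l : (j l < p)%N.
      rewrite ltn_neqAle -ltnS ltn_ord andbT.
      by apply: contra nj => jl; apply/existsP; exists l; rewrite -val_eqE.
    exists [ffun l => Ordinal (jp l)].
      by rewrite inE; apply/increasingP => l l' /ij; rewrite !ffunE.
    by apply/ffunP => l; rewrite !ffunE; apply: val_inj.
  rewrite inE => /increasingP ij; split.
    by apply/increasingP => l l' /ij; rewrite !ffunE.
  apply/negP => /existsP[l]; rewrite ffunE -val_eqE /= => /eqP jl.
  by have := ltn_ord (j' l); rewrite jl ltnn.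
rewrite big_imset /=; last first.
  move=> j j' _ _ /ffunP jj; apply/ffunP => l.
  by apply: widen_inj; have := jj l; rewrite !ffunE.
rewrite (lin_sum (op_linl _)); under eq_bigl do rewrite inE.
apply: eq_bigr => j ij; rewrite (linZ (op_linl _)); congr (_ *: _).
  by congr (_ ^+ _); apply: eq_bigr => l _; rewrite ffunE.
rewrite /insertion_prod big_op_recr; congr op.
  apply: eq_bigr => i _.
  have -> : [pick l | widenf j l == widen_ord (leqnSn p) i] =
    [pick l | j l == i].
    by apply: eq_pick => l; rewrite ffunE -val_eqE.
  by [].
case: pickP => // l; rewrite ffunE -val_eqE /= => /eqP jl.
by have := ltn_ord (j l); rewrite jl ltnn.
Qed.

(** A strictly increasing family that reaches the last place does so with its
    last argument; the rest is a family for one place and one argument fewer,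
    and the sign of the last argument depends only on p, k and the degrees. *)
Lemma insertion_sum_hit p k : \sum_(j : {ffun 'I_k.+1 -> 'I_p.+1} |
    increasing j && [exists l, j l == ord_max]) (-1) ^+ insertion_sign j *:
      insertion_prod j =
  (-1) ^+ ((p - k + \sum_(l < k) q l) * (q k).+1)%N *:
    op (insertion_sum p k) (d p k).
Proof.
transitivity (\sum_(j in @extendf p k @: [set j | increasing j])
    (-1) ^+ insertion_sign j *: insertion_prod j).
  apply: eq_bigl => j; apply/andP/imsetP => [[/increasingP ij]|[j' + ->]].
    case/existsP=> m /eqP jm.
    have jp (l : 'I_k) : (j (widen_ord (leqnSn k) l) < p)%N.
      apply: (@leq_trans (j ord_max)); first by apply: ij; rewrite /= ltn_ord.
      by rewrite -ltnS ltn_ord.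
    have jmax : j ord_max = ord_max.
      case: (ord_recr m) => [<- //|[l ml]].
      by have := jp l; rewrite -ml jm ltnn.
    exists [ffun l => Ordinal (jp l)].
      by rewrite inE; apply/increasingP => l l' ll'; rewrite !ffunE; apply: ij.
    apply/ffunP => l; case: (ord_recr l) => [->|[l' ->]].
      by rewrite extendf_max.
    by rewrite extendf_widen ffunE; apply: val_inj.
  rewrite inE => /increasingP ij; split; last first.
    by apply/existsP; exists ord_max; rewrite extendf_max.
  apply/increasingP => l l'.
  case: (ord_recr l) => [->|[i ->]]; case: (ord_recr l') => [->|[i' ->]] /=.
  - by rewrite ltnn.
  - by rewrite ltnNge ltnW.
  - by rewrite extendf_widen extendf_max /=.
  - by rewrite !extendf_widen; apply: ij.
rewrite big_imset /=; last first.
  move=> j j' _ _ /ffunP jj; apply/ffunP => l; apply: widen_inj.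
  by rewrite -!extendf_widen jj.
rewrite (lin_sum (op_linl _)) scaler_sumr; under eq_bigl do rewrite inE.
apply: eq_bigr => j ij; rewrite (linZ (op_linl _)) scalerA -exprD.
congr (_ ^+ _ *: _).
  (* The last argument sits at place p; its exponent is split off. *)
  rewrite /insertion_sign big_ord_recr extendf_max [LHS]addnC; congr (_ + _)%N.
    congr (_ * _)%N; congr (_ + _)%N;
      rewrite big_mkcond big_ord_recr /= ltnn addn0.
    by apply: eq_bigr => l _; rewrite ltn_ord.
  apply: eq_bigr => l _; rewrite extendf_widen /=; congr ((_ + _) * _)%N.
  rewrite big_mkcond big_ord_recr /= ltnNge (ltnW (ltn_ord l)) addn0.
  by rewrite [RHS]big_mkcond.
rewrite /insertion_prod big_op_recr; congr op.
  apply: eq_bigr => i _; case: pickP => [l|nl].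
    case: (ord_recr l) => [->|[l' ->]].
      by rewrite extendf_max -val_eqE /= => /eqP pi; have := ltn_ord i;
        rewrite -pi ltnn.
    rewrite extendf_widen => /eqP/widen_inj jl.
    case: pickP => [l'' /eqP jl''|/(_ l')]; last by rewrite jl eqxx.
    rewrite /=; congr (d _ _); move/increasingP: ij => ij.
    have [ll|ll|//] := ltngtP l' l''; have := ij _ _ ll;
      rewrite jl jl'' ?ltnn //.
  case: pickP => [l /eqP jl|//].
  by have := nl (widen_ord (leqnSn k) l); rewrite extendf_widen jl eqxx.
case: pickP => [l /eqP|/(_ ord_max)]; last by rewrite extendf_max eqxx.
case: (ord_recr l) => [-> //|[l' ->]];
  rewrite extendf_widen => /(congr1 val) /= jl.
by have := ltn_ord (j l'); rewrite jl ltnn.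
Qed.

Lemma insertion_sum0 k : insertion_sum 0 k = if k is 0 then e else 0.
Proof.
case: k => [|k]; last by apply: big1 => j; case: (j ord0).
rewrite /insertion_sum (big_pred1 [ffun l : 'I_0 => (l : 'I_0)]) => [|j].
  by rewrite /insertion_sign /insertion_prod !big_ord0 expr0 scale1r.
have -> : j = [ffun l : 'I_0 => (l : 'I_0)] by apply/ffunP => -[].
by rewrite /= eqxx; apply/increasingP => -[].
Qed.

Lemma insertion_sumS p k : insertion_sum p.+1 k = op (insertion_sum p k) (c p) +
  (if k is k'.+1 then (-1) ^+ ((p - k' + \sum_(l < k') q l) * (q k').+1)%N *:
     op (insertion_sum p k') (d p k') else 0).
Proof.
rewrite {1}/insertion_sum (bigID
  (fun j : {ffun _ -> _} => [exists l, j l == ord_max])) /=.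
rewrite insertion_sum_miss addrC; congr (_ + _); case: k => [|k];
  last exact: insertion_sum_hit.
by apply: big1 => j /andP[_ /existsP[[]]].
Qed.

Lemma insertion_sum_gt p k : (p < k)%N -> insertion_sum p k = 0.
Proof.
elim: p k => [|p IH] [|k] // pk;
  rewrite ?insertion_sum0 // insertion_sumS !IH //; last exact: ltnW.
by rewrite !(lin0 (op_linl _)) scaler0 addr0.
Qed.
End InsertionSums.

(** * The action through iterated coproducts *)

Section FactorwiseAction.
Variables (K : fieldType) (R : lmodType K) (H : algType K) (D : hopf_data R H).
Local Notation T := (tpow D).
Local Notation ten := (ten D).
Local Notation inR := (inR D).
Local Notation inH := (inH D).

Let mulw (s w : seq H) := [seq p.1 * p.2 | p <- zip s w].

Lemma split_size (w : seq H) m n : (m + n == size w)%N ->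
  exists w1 w2, [/\ w = w1 ++ w2, size w1 = m & size w2 = n].
Proof.
move=> /eqP E; exists (take m w), (drop m w); rewrite cat_take_drop size_drop.
by rewrite size_takel -E ?leq_addr // addKn.
Qed.

Lemma tact_balanced w : gen_balanced D (fun g => if g is inr s then
  if size s == size w then ten (mulw s w) else 0 else 0).
Proof.
have tw := ten_word_balanced D.
split; first exact: linear_zero.
split=> [s1 s2 c x y|r x y s1 s2]; rewrite !size_cat.
  case: ifP => [|_]; last by rewrite scaler0 addr0.
  move=> /split_size[w1 [[|z w2] [-> ws //=]]] _.
  rewrite /mulw !zip_cat // !map_cat /= mulrDl -scalerAl.
  exact: (wbal_l tw).
case: ifP => // /split_size[w1 [[|z [|z' w2]] [-> ws //=]]] _.
rewrite /mulw !zip_cat // !map_cat /= -!mulrA.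
exact: (wbal_m tw).
Qed.

Lemma tact_linear w : linear (tact (D := D) ^~ w).
Proof. exact/tlift_linear/tact_balanced. Qed.

Lemma tact_ten x s w : tact (ten (x :: s)) w =
  if size (x :: s) == size w then ten (mulw (x :: s) w) else 0.
Proof. exact: (tlift_ten (tact_balanced w)). Qed.

Lemma tact_inR r w : tact (inR r) w = 0.
Proof. exact: (tlift_inR (tact_balanced w)). Qed.

Hypothesis hB : base_axioms D.

(** The condition on w excludes the base component of t, which is killed on the
    right but contributes a word of length one on the left. *)
Lemma tact_app t y w z : (0 < size w)%N ->
  tact (tcat t (inH y)) (rcons w z) = tcat (tact t w) (inH (y * z)).
Proof.
move=> w0; move: t; apply: tpow_ext => [||r|x s].
- exact: (linear_comp (tact_linear _) (tcat_linl hB _)).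
- exact: (linear_comp (tcat_linl hB _) (tact_linear _)).
- rewrite (tcat_RW hB) tact_ten tact_inR (tcat0l hB) size_rcons.
  by case: w w0.
- rewrite -(ten_rcons hB) rcons_cons !tact_ten -rcons_cons !size_rcons eqSS.
  case: eqP => [e|_]; last by rewrite (tcat0l hB).
  by rewrite -(ten_rcons hB) /mulw zip_rcons // map_rcons.
Qed.

Lemma dact1 h x : dact D h (inr [:: x]) = inH (h * x).
Proof. exact: tact_ten. Qed.

(** Proved from the axioms on the base alone in order to apply to the twist,
    where icomul refers to the twisted coproduct. *)
Lemma dact_rcons h w z : (0 < size w)%N -> dact D h (inr (rcons w z)) =
  hlift (fun x y => tcat (dact D x (inr w)) (inH (y * z))) (comul D h).
Proof.
case: w => // a w _; rewrite /dact size_rcons [_.+1.-1]/= [icomul _ _ _]/=.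
rewrite (hlift_comp _ _ (tact_linear _)); apply: eq_hlift => x y.
by rewrite tact_app.
Qed.
End FactorwiseAction.

(** For a Hopf algebroid the definition by iterated coproducts agrees with act,
    since both satisfy the same recursion on words. *)
Lemma dact_act (K : fieldType) (R : lmodType K) (H : algType K)
    (D : hopf_data R H) (hD : hopf_algebroid D) h :
  (forall r, dact D h (inl r) = act h (inR D r)) /\
  (forall x s, dact D h (inr (x :: s)) = act h (ten D (x :: s))).
Proof.
have hB := hopf_base hD.
split=> [r|x s]; first by rewrite (act_inR hD).
elim/last_ind: s x h => [|s z IH] x h; first by rewrite dact1 (act_inH hD).
rewrite -rcons_cons dact_rcons // (ten_rcons hB) (act_app hD).
by apply: eq_hlift => u v; rewrite IH.
Qed.

(** * Braces *)

Section MultiLinear.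
Variables (K : fieldType) (R : lmodType K) (H : algType K) (D : hopf_data R H).

(** Empty words never occur in a tensor, so f and G are compared on the other
    generators only. *)
Lemma mlift_eval (V : lmodType K) (G : seq (tpow D) -> V) us
    (f : seq (gen R H) -> V) :
  (forall us1 us2, linear (fun u => G (us1 ++ u :: us2))) ->
  (forall gs, size gs = size us -> all (fun g => g != inr [::]) gs ->
    f gs = G (map (gval D) gs)) -> mlift f us = G us.
Proof.
elim: us f G => [|u us IH] f G GL fG /=; first exact: fG.
apply: (tlift_eval (G := fun u => G (u :: us))); first exact: (GL [::] us).
- move=> r; apply: (IH _ (fun us => G (inR D r :: us))) => [us1 us2|gs sz ag].
    exact: (GL (inR D r :: us1) us2).
  by rewrite fG //= sz.
- move=> x s; apply: (IH _ (fun us => G (ten D (x :: s) :: us))) =>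
  [us1 us2|gs sz ag].
    exact: (GL (ten D (x :: s) :: us1) us2).
  by rewrite fG //= sz.
Qed.

Lemma mlift_comp (V W : lmodType K) (L : V -> W) (f : seq (gen R H) -> V)
    (us : seq (tpow D)) : linear L -> L (mlift f us) =
      mlift (fun gs => L (f gs)) us.
Proof.
move=> LL; elim: us f => [|u us IH] f //=.
by rewrite (tlift_comp _ _ LL); congr tlift; apply: funext => g; rewrite IH.
Qed.
End MultiLinear.

Section BraceRecursion.
Variables (K : fieldType) (R : lmodType K) (H : algType K) (D : hopf_data R H).
Hypothesis hD : hopf_algebroid D.
Let hB : base_axioms D := hopf_base hD.
Local Notation T := (tpow D).
Local Notation ten := (ten D).
Local Notation inR := (inR D).
Local Notation inH := (inH D).
Local Notation e := (inR (bone D)).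

(** For homogeneous t and u of degrees m and n this is the product with sign
    (-1)^(m (n + 1)), the sign with which the last argument of a brace enters.
    Splitting u by parity makes it bilinear. *)
Definition sprod (op : T -> T -> T) (t u : T) : T :=
  op t (degpart odd u) + op (sgn t) (degpart (predC odd) u).

(** Braces of a word by recursion on its last letter x: either x is left alone
    or it receives the last argument. Word and arguments are listed backwards.
    The product is a parameter in order to treat (x) and the twisted product at
    once. *)
Fixpoint wbrace (op : T -> T -> T) (s : seq H) (us : seq T) : T :=
  if s is x :: s' then
    op (wbrace op s' us) (inH x) +
    (if us is u :: us' then sprod op (wbrace op s' us') (act x u) else 0)
  else if us is [::] then e else 0.

Section Op.
Variable op : T -> T -> T.
Hypotheses (op_linl : forall v, linear (fun u => op u v))
           (op_linr : forall u, linear (op u)).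

Lemma sprod_linl u : linear (fun t => sprod op t u).
Proof.
by apply: linear_add => //;
  exact: (linear_comp (op_linl _) (@sgn_linear _ _ _ D)).
Qed.

Lemma sprod_linr t : linear (sprod op t).
Proof.
by apply: linear_add; exact: (linear_comp (op_linr _)
  (@degpart_linear _ _ _ D _)).
Qed.

Lemma sprod_graded t n u : graded n u ->
  sprod op t u = if odd n then op t u else op (sgn t) u.
Proof.
move=> un; rewrite /sprod !un /=; case: (odd n) => /=.
  by rewrite (lin0 (op_linr _)) addr0.
by rewrite (lin0 (op_linr _)) add0r.
Qed.

Lemma wbrace_lin s us1 us2 : linear (fun u => wbrace op s (us1 ++ u :: us2)).
Proof.
elim: s us1 us2 => [|x s IH] us1 us2 /=.
  by case: us1 => [|v us1] c a b /=; rewrite scaler0 addr0.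
apply: linear_add; first exact: (linear_comp (op_linl _) (IH us1 us2)).
case: us1 => [|v us1] /=; first exact: (linear_comp (sprod_linr _)
  (act_linr hD x)).
exact: (linear_comp (sprod_linl _) (IH us1 us2)).
Qed.

Hypotheses (opA : associative op) (op1l : left_id e op) (op1r : right_id e op).
Hypothesis op_sgn : forall t u, sgn (op t u) = op (sgn t) (sgn u).

Section Insertion.
Variables (q : nat -> nat) (s : seq H) (us : seq T).
Hypothesis usq : forall l, graded (q l) us`_l.
Local Notation BS := (insertion_sum op e q (fun i => inH s`_i)
  (fun i l => act s`_i us`_l)).

Let actq l x : graded (q l) (act x us`_l).
Proof.
by move=> P; rewrite (degpart_act hD) usq; case: (P _);
  rewrite ?(lin0 (act_linr hD x)).
Qed.

(** Each insertion replaces a letter by an argument, so the degree is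
    p - k + q 0 + ... + q (k - 1). For p < k the sum vanishes, and the truncated
    subtraction does no harm. *)
Lemma sgn_insertion_sum p k : sgn (BS p k) =
  (-1) ^+ (p - k + \sum_(l < k) q l) *: BS p k.
Proof.
have sL := @sgn_linear _ _ _ D; elim: p k => [|p IH] k.
  rewrite !insertion_sum0; case: k => [|k]; last by rewrite (lin0 sL) scaler0.
  rewrite (graded_sgn (graded_inR D _)); congr (_ ^+ _ *: _).
  by rewrite big_ord0.
have [pk|kp] := ltnP p.+1 k.
  by rewrite (insertion_sum_gt opA op1l op1r op_linl) // (lin0 sL) scaler0.
rewrite (insertion_sumS opA op1l op1r op_linl) (linD sL) scalerDr;
  congr (_ + _).
  rewrite op_sgn IH (graded_sgn (graded_ten D [:: _])) expr1 scaleN1r.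
  rewrite (linN (op_linr _)) (linZ (op_linl _)) -scaleN1r scalerA -exprS.
  have [kp'|pk] := leqP k p; first by rewrite subSn.
  by rewrite (insertion_sum_gt opA op1l op1r op_linl) // (lin0 (op_linl _))
    !scaler0.
case: k kp => [|k] kp; first by rewrite (lin0 sL) scaler0.
rewrite (linZ sL) op_sgn IH (graded_sgn (actq _ _)).
rewrite (linZ (op_linl _)) (linZ (op_linr _)) !scalerA; congr (_ *: _).
rewrite big_ord_recr subSS addnA [in RHS]exprD [RHS]mulrC -[LHS]mulrA.
by congr (_ * _); rewrite mulrC.
Qed.

(** Both sides satisfy the same recursion, by splitting the families of
    positions according to whether the last place is used. *)
Lemma insertion_sum_wbrace p k : (p <= size s)%N -> (k <= size us)%N ->
  BS p k = wbrace op (rev (take p s)) (rev (take k us)).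
Proof.
elim: p k => [|p IH] k ps ku.
  rewrite insertion_sum0 take0 /=; case: k ku => [|k] ku;
    first by rewrite take0.
  by rewrite (take_nth 0) // rev_rcons.
rewrite (insertion_sumS opA op1l op1r op_linl) (take_nth 0) // rev_rcons /=
  -!IH ?(ltnW ps) //.
congr (_ + _); case: k ku => [|k] ku; first by rewrite take0.
rewrite [in RHS](take_nth 0) // rev_rcons -IH ?(ltnW ps) ?(ltnW ku) //.
rewrite (sprod_graded _ (actq _ _)) sgn_insertion_sum (linZ (op_linl _)).
set a := (_ + _)%N; rewrite -signr_odd oddM /=.
case: (odd (q k)); rewrite ?andbF ?andbT ?expr0 ?scale1r //=.
by rewrite signr_odd.
Qed.
End Insertion.
End Op.

Let cL := tcat_linl hB.
Let cR := tcat_linr hB.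
Local Notation bt := (wbrace (@tcat _ _ _ D)).
Local Notation sp := (sprod (@tcat _ _ _ D)).

Lemma sprod_inRl t r u : sp (tcat t (inR r)) u = sp t (tcat (inR r) u).
Proof.
rewrite /sprod -!(act_tgt1 hD) -!(act_src1 hD) (sgn_act hD) !(degpart_act hD).
by rewrite !(act_tgt1 hD) !(act_src1 hD) !(tcatA hB).
Qed.

Lemma sprod_inRr t r u : tcat (sp t u) (inR r) = sp t (tcat u (inR r)).
Proof.
rewrite /sprod -[tcat u _](act_tgt1 hD) !(degpart_act hD) !(act_tgt1 hD).
by rewrite (linD (cL _)) !(tcatA hB).
Qed.

Lemma bt_wlin s1 s2 us : linear (fun x => bt (s1 ++ x :: s2) us).
Proof.
elim: s1 us => [|a s1 IH] us /=.
  apply: linear_add.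
    exact: (linear_comp (cR _) (@inH_linear _ _ _ D)).
  case: us => [|u us]; first exact: linear_zero.
  exact: (linear_comp (sprod_linr cR _) (act_linl hD u)).
apply: linear_add; first exact: (linear_comp (cL _) (IH us)).
case: us => [|u us]; first exact: linear_zero.
exact: (linear_comp (sprod_linl cL _) (IH us)).
Qed.

Lemma bt_cons x s us : bt (x :: s) us = tcat (bt s us) (inH x) +
  (if us is u :: us' then sp (bt s us') (act x u) else 0).
Proof. by []. Qed.

Lemma bt_tgt r x s us : bt (tgt D r * x :: s) us =
  tcat (bt (x :: s) us) (inR r).
Proof.
rewrite /= (linD (cL _)) -(tcatA hB) (tcat_WR hB [::]); congr (_ + _).
case: us => [|u us]; first by rewrite (tcat0l hB).
by rewrite sprod_inRr (act_tgt hD).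
Qed.

Lemma bt_wbal r x y s1 s2 us : bt (s1 ++ [:: y, tgt D r * x & s2]) us =
  bt (s1 ++ [:: src D r * y, x & s2]) us.
Proof.
elim: s1 us => [|a s1 IH] us; last first.
  by rewrite /= IH; congr (_ + _); case: us => [//|u us]; rewrite IH.
rewrite ![_ ++ _]/= [LHS]bt_cons [RHS]bt_cons bt_tgt -(tcatA hB) (tcat_RW hB).
case: us => [//|u us].
by rewrite bt_tgt sprod_inRl (act_src hD).
Qed.

(** The brace with its arguments listed backwards, as a map that is visibly
    multilinear and well defined on T; tbraceE identifies it with the brace of
    the B_infinity structure. *)
Definition rbrace (t : T) (us : seq T) : T :=
  tlift (fun g => match g with
    | inl r => if us is [::] then inR r else 0
    | inr s => bt (rev s) us
    end) t.

Lemma rbrace_balanced us : gen_balanced D (fun g => match g with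
  | inl r => if us is [::] then inR r else 0 | inr s => bt (rev s) us end).
Proof.
split; first by case: us => [|u us]; [exact: inR_linear|exact: linear_zero].
split=> [s1 s2|r x y s1 s2].
  by move=> c x y; rewrite !rev_cat !rev_cons -!cats1 -!catA; apply: bt_wlin.
by rewrite !rev_cat !rev_cons -!cats1 -!catA; apply: bt_wbal.
Qed.

Lemma rbrace_linl us : linear (rbrace ^~ us).
Proof. exact/tlift_linear/rbrace_balanced. Qed.

Lemma rbrace_linr t us1 us2 : linear (fun u => rbrace t (us1 ++ u :: us2)).
Proof.
apply: tlift_param => [r|x s]; last exact: (wbrace_lin cL cR).
by case: us1 => [|v us1] c a b /=; rewrite scaler0 addr0.
Qed.

Lemma rbrace_inR r us : rbrace (inR r) us = if us is [::] then inR r else 0.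
Proof. exact: (tlift_inR (rbrace_balanced us)). Qed.

Lemma rbrace_ten s us : rbrace (ten s) us = bt (rev s) us.
Proof. by case: s => [|x s];
  [exact: rbrace_inR | exact: (tlift_ten (rbrace_balanced us))]. Qed.

Lemma rbrace_app t x us : rbrace (tcat t (inH x)) us =
  tcat (rbrace t us) (inH x) +
  (if us is u :: us' then sp (rbrace t us') (act x u) else 0).
Proof.
move: t; apply: tpow_ext => [||r|y s].
- exact: (linear_comp (rbrace_linl us) (cL _)).
- apply: linear_add; first exact: (linear_comp (cL _) (rbrace_linl us)).
  case: us => [|u us]; first exact: linear_zero.
  exact: (linear_comp (sprod_linl cL _) (rbrace_linl us)).
- rewrite (tcat_RW hB) rbrace_ten /= rbrace_inR; case: us => [|u us].
    by rewrite !addr0 (tcat1l hB) (tcat_RW hB).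
  rewrite !(tcat0l hB) !add0r rbrace_inR; case: us => [|v us].
    by rewrite (act_src hD) -sprod_inRl (tcat1l hB).
  by rewrite !(lin0 (sprod_linl cL _)).
- rewrite -(ten_rcons hB) !rbrace_ten rev_rcons bt_cons; congr (_ + _).
  by case: us => [//|u us]; rewrite rbrace_ten.
Qed.

Lemma rbrace_nil t : rbrace t [::] = t.
Proof.
elim/(tpow_ind hB): t => [c t u Et Eu|r|t x Et].
- by rewrite rbrace_linl Et Eu.
- exact: rbrace_inR.
- by rewrite rbrace_app addr0 Et.
Qed.

Lemma act_sprod h t u : act h (sp t u) =
  hlift (fun y z => sp (act y t) (act z u)) (comul D h).
Proof.
rewrite /sprod (linD (act_linr hD h)) !(act_tcat hD) -hlift_add.
by apply: eq_hlift => y z; rewrite !(degpart_act hD) (sgn_act hD).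
Qed.

Lemma sprod_twcat (F : htens (src D) (tgt D)) t u : sprod (twcat F) t u =
  hlift (fun y z => sp (act y t) (act z u)) F.
Proof.
rewrite /sprod -hlift_add.
by apply: eq_hlift => y z; rewrite !(degpart_act hD) (sgn_act hD).
Qed.

(** A coproduct of h is distributed over the factors of t, and on a factor
    that receives u it gives (h x) . u = h . (x . u). *)
Lemma rbrace_act h t us : rbrace (act h t) us = act h (rbrace t us).
Proof.
elim/(tpow_ind hB): t us h => [c t u Et Eu|r|t x E] us h.
- by rewrite (act_linr hD) !rbrace_linl (act_linr hD) Et Eu.
- rewrite (act_inR hD) !rbrace_inR; case: us => [|u us];
  first by rewrite (act_inR hD).
  by rewrite (lin0 (act_linr hD h)).
rewrite rbrace_app (linD (act_linr hD h)) !(act_app hD)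
  (hlift_comp _ _ (rbrace_linl us)).
transitivity (hlift (fun y z => tcat (act y (rbrace t us)) (inH (z * x)) +
   (if us is u :: us' then sp (act y (rbrace t us')) (act z (act x u)) else 0))
     (comul D h)).
  apply: eq_hlift => y z; rewrite rbrace_app E; congr (_ + _).
  by case: us => [//|u us]; rewrite E (actM hD).
rewrite hlift_add; congr (_ + _); case: us => [|u us];
  last by rewrite act_sprod.
rewrite (lin0 (act_linr hD h)).
by apply: (hlift_eval (g := fun=> 0)) => //; exact: linear_zero.
Qed.

(** Since t ** x is a sum of products (F1 t) (x) (F2 x), this combines the
    recursion for (x) with the H-linearity of the brace. *)
Lemma rbrace_twcat_app (F : htens (src D) (tgt D)) t x us :
  rbrace (twcat F t (inH x)) us = twcat F (rbrace t us) (inH x) +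
  (if us is u :: us' then sprod (twcat F) (rbrace t us') (act x u) else 0).
Proof.
rewrite (hlift_comp _ _ (rbrace_linl us)).
transitivity (hlift (fun y z => tcat (act y (rbrace t us)) (inH (z * x)) +
   (if us is u :: us' then sp (act y (rbrace t us')) (act z (act x u)) else 0))
     F).
  apply: eq_hlift => y z; rewrite (act_inH hD) rbrace_app rbrace_act;
    congr (_ + _).
  by case: us => [//|u us]; rewrite rbrace_act (actM hD).
rewrite hlift_add; congr (_ + _).
  by apply: eq_hlift => y z; rewrite (act_inH hD).
case: us => [|u us]; last by rewrite sprod_twcat.
by apply: (hlift_eval (g := fun=> 0)) => //; exact: linear_zero.
Qed.

Lemma gval_nth gs l : (map (gval D) gs)`_l = gval D (nth (inl 0) gs l).
Proof.
have [lg|gl] := ltnP l (size gs); first by rewrite (nth_map (inl 0)).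
by rewrite !nth_default ?size_map.
Qed.

(** The defining sum of the brace is the insertion sum for (x). *)
Lemma gbrace_wbrace s gs : all (fun g => g != inr [::]) gs ->
  gbrace D (inr s) gs = bt (rev s) (rev (map (gval D) gs)).
Proof.
move=> /allP ag.
have usq l : graded (gdeg (nth (inl 0) gs l)) (map (gval D) gs)`_l.
  by rewrite gval_nth; exact: graded_gval.
have := insertion_sum_wbrace cL cR (tcatA hB) (tcat1l hB) (tcat1r hB)
  (sgn_tcat hD) usq
  (leqnn (size s)) (leqnn _).
rewrite !take_size => <-; rewrite size_map.
apply: eq_bigr => j _; congr (_ *: _); apply: eq_bigr => i _.
case: pickP => // l _; rewrite gval_nth.
have /ag : nth (inl 0) gs l \in gs by rewrite mem_nth.
have [dl dr] := dact_act hD s`_i.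
by case: (nth (inl 0) gs l) => [r|[|x w]] h; [exact: dl|by []|exact: dr].
Qed.

(** Both sides are determined by their values on generators, as rbrace is
    multilinear. *)
Lemma tbraceE t us : tbrace t us = rbrace t (rev us).
Proof.
have ML t' us1 us2 : linear (fun u => rbrace t' (rev (us1 ++ u :: us2))).
  by move=> c x y; rewrite !rev_cat !rev_cons -!cats1 -!catA;
    apply: rbrace_linr.
apply: tlift_eval => [|r|x s]; first exact: rbrace_linl.
  apply: (mlift_eval (G := fun us => rbrace (inR r) (rev us))) => // gs sz _ /=.
  rewrite rbrace_inR; case: gs {sz} => [|g gs] //=.
  by rewrite rev_cons; case: (rev _).
apply: (mlift_eval (G := fun us => rbrace (ten (x :: s)) (rev us))) => // gs sz
  ag.
by rewrite rbrace_ten gbrace_wbrace.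
Qed.
End BraceRecursion.

(** * The comparison map *)

Section Comparison.
Variables (K : fieldType) (R : lmodType K) (H : algType K) (D : hopf_data R H).
Variable F : htens (src D) (tgt D).
Hypothesis hD : hopf_algebroid D.
Hypothesis hF : twistor F.
Let hB : base_axioms D := hopf_base hD.
Let hB' : base_axioms (twist F) := twist_base hD hF.
Local Notation T := (tpow D).
Local Notation T' := (tpow (twist F)).
Local Notation inR := (inR D).
Local Notation inH := (inH D).
Local Notation e := (inR (bone D)).
Local Notation "A ** B" := (twcat F A B) (at level 40, left associativity).

Let dL := twcat_linl F hD.
Let dR := twcat_linr F hD.
Let dA := twcatA hD hF.

(** The iterated brace with F; see iterbraceE. *)
Definition fsharp_word (s : seq H) : T := foldl (fun t y => t ** inH y) e s.

Lemma fsharp_word_rcons s x : fsharp_word (rcons s x) = fsharp_word s ** inH x.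
Proof. exact: foldl_rcons. Qed.

Lemma fsharp_word1 x : fsharp_word [:: x] = inH x.
Proof. exact: twcat1l. Qed.

Lemma fsharp_word_cat s s' : fsharp_word (s ++ s') =
  fsharp_word s ** fsharp_word s'.
Proof.
elim/last_ind: s' => [|s' x IH];
  first by rewrite cats0 [fsharp_word [::]]/= twcat1r.
by rewrite -rcons_cat !fsharp_word_rcons IH dA.
Qed.

Lemma fsharp_word_cons x s : fsharp_word (x :: s) = inH x ** fsharp_word s.
Proof. by rewrite -cat1s fsharp_word_cat fsharp_word1. Qed.

Lemma graded_fsharp_word s : graded (size s) (fsharp_word s).
Proof.
elim/last_ind: s => [|s x IH]; first exact: graded_inR.
by rewrite fsharp_word_rcons size_rcons; apply: graded_twcat_app.
Qed.

(** Well defined because the twisted source and target maps are the left and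
    right multiplications by R for the twisted product. *)
Definition fsharp (t : T') : T :=
  tlift (fun g => match g with inl r => inR r | inr s => fsharp_word s end) t.

Lemma fsharp_balanced : gen_balanced (twist F)
  (fun g => match g with inl r => inR r | inr s => fsharp_word s end).
Proof.
split; first exact: inR_linear.
split=> [s1 s2|r x y s1 s2].
  move=> c x y; rewrite !fsharp_word_cat !fsharp_word_cons.
  by rewrite (@inH_linear _ _ _ D) dL dR.
by rewrite !fsharp_word_cat !fsharp_word_cons; congr (_ ** _);
  rewrite !dA twcat_HRH.
Qed.

Lemma fsharp_linear : linear fsharp.
Proof. exact/tlift_linear/fsharp_balanced. Qed.

Lemma fsharp_inR r : fsharp (Defs.inR (twist F) r) = inR r.
Proof. exact: (tlift_inR fsharp_balanced). Qed.

Lemma fsharp_ten s : fsharp (ten (twist F) s) = fsharp_word s.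
Proof. by case: s => [|x s];
  [exact: fsharp_inR | exact: (tlift_ten fsharp_balanced)]. Qed.

Lemma fsharp_inH x : fsharp (Defs.inH (twist F) x) = inH x.
Proof. by rewrite fsharp_ten fsharp_word1. Qed.

Lemma graded_fsharp g : graded (gdeg g) (fsharp (gval (twist F) g)).
Proof.
case: g => [r|s] /=; first by rewrite fsharp_inR; exact: graded_inR.
by rewrite fsharp_ten; exact: graded_fsharp_word.
Qed.

Lemma fsharp_tcat_inH t x : fsharp (tcat t (Defs.inH (twist F) x)) =
  fsharp t ** inH x.
Proof.
move: t; apply: tpow_ext => [||r|y s].
- exact: (linear_comp fsharp_linear (tcat_linl hB' _)).
- exact: (linear_comp (dL _) fsharp_linear).
- by rewrite (tcat_RW hB') fsharp_ten fsharp_inR fsharp_word1 twcat_RH.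
- by rewrite -(ten_rcons hB') !fsharp_ten fsharp_word_rcons.
Qed.

Lemma fsharp_tcat t u : fsharp (tcat t u) = fsharp t ** fsharp u.
Proof.
elim/(tpow_ind hB'): u => [c u v Eu Ev|r|u x E].
- by rewrite (tcat_linr hB') !fsharp_linear Eu Ev dR.
- rewrite fsharp_inR; move: t; apply: tpow_ext => [||a|y s].
  + exact: (linear_comp fsharp_linear (tcat_linl hB' _)).
  + exact: (linear_comp (dL _) fsharp_linear).
  + by rewrite (tcat_RR hB') !fsharp_inR twcat_RR.
  + rewrite lastI (tcat_WR hB') !fsharp_ten !fsharp_word_rcons -dA;
    congr (_ ** _).
    by rewrite twcat_HR.
- by rewrite (tcatA hB') !fsharp_tcat_inH E dA.
Qed.

(** The action on R only depends on the counit: both sides are the action of h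
    on r = r ** 1. *)
Lemma hact_twist h r : hact (twist F) h r = hact D h r.
Proof.
have E k : counit D k = hact D k (bone D) by rewrite /hact (src1 hD) mulr1.
rewrite [LHS]/hact /= E (hactM hD); congr hact.
have := twcat1r hD hF (inR r); rewrite (twcat_inRl _ hD) (act_inR hD).
exact: (@inR_inj _ _ _ D).
Qed.

(** Both recursions split off the last letter by a coproduct, and
    act_twcat_twcomul matches the twisted coproduct with the action. *)
Lemma fsharp_dact h g : g != inr [::] ->
  fsharp (dact (twist F) h g) = act h (fsharp (gval (twist F) g)).
Proof.
case: g => [r|[|x s]] // _.
  by rewrite [dact _ _ _]/(Defs.inR _ (hact (twist F) h r)) !fsharp_inR
    (act_inR hD) hact_twist.
rewrite fsharp_ten; elim/last_ind: s x h => [|s z IH] x h.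
  by rewrite dact1 fsharp_inH fsharp_word1 (act_inH hD).
rewrite -rcons_cons (dact_rcons hB') // (hlift_comp _ _ fsharp_linear)
  fsharp_word_rcons.
rewrite (act_twcat_twcomul hD hF); apply: eq_hlift => u v.
by rewrite fsharp_tcat_inH IH (act_inH hD).
Qed.

Lemma fsharp_degpart P t : fsharp (degpart P t) = degpart P (fsharp t).
Proof.
have pL := fsharp_linear.
move: t; apply: tpow_ext => [||r|x s].
- exact: (linear_comp pL (degpart_linear _)).
- exact: (linear_comp (degpart_linear _) pL).
- by rewrite fsharp_inR !degpart_inR; case: (P _);
  rewrite ?fsharp_inR ?(lin0 pL).
- rewrite degpart_ten fsharp_ten graded_fsharp_word.
  by case: (P _); rewrite ?(lin0 pL) // fsharp_ten.
Qed.

Lemma fsharp_homog n t : homog n t -> homog n (fsharp t).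
Proof. by move=> /homogP tn; apply/homogP; rewrite -fsharp_degpart tn. Qed.

(** The recursions for the brace of t ** x and for wbrace agree. *)
Lemma rbrace_fsharp_word s us : rbrace (fsharp_word s) us =
  wbrace (twcat F) (rev s) us.
Proof.
elim/last_ind: s us => [|s x IH] us; first exact: (rbrace_inR hD).
rewrite fsharp_word_rcons rev_rcons (rbrace_twcat_app hD) /= IH; congr (_ + _).
by case: us => [//|u us]; rewrite IH.
Qed.

(** The comparison map turns the defining sum for the twist into the same sum
    for the product **, which is the brace of an iterated twisted product. *)
Lemma fsharp_gbrace g gs : all (fun g => g != inr [::]) gs ->
  fsharp (gbrace (twist F) g gs) =
  tbrace (fsharp (gval (twist F) g)) (map fsharp (map (gval (twist F)) gs)).
Proof.
move=> ag; rewrite (tbraceE hD); case: g => [r|s].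
  rewrite fsharp_inR (rbrace_inR hD) /=; case: gs {ag} => [|g gs] /=;
    first exact: fsharp_inR.
  by rewrite rev_cons (lin0 fsharp_linear); case: (rev _).
rewrite -[gval _ _]/(ten (twist F) s) fsharp_ten rbrace_fsharp_word.
set us := map fsharp _.
have usE l : us`_l = fsharp (gval (twist F) (nth (inl 0) gs l)).
  rewrite /us -map_comp; have [lg|gl] := ltnP l (size gs).
    by rewrite (nth_map (inl 0)).
  by rewrite !nth_default ?size_map //= -[LHS](lin0 fsharp_linear).
have usq l : graded (gdeg (nth (inl 0) gs l)) us`_l by rewrite usE;
  exact: graded_fsharp.
have szu : size us = size gs by rewrite !size_map.
(* The defining sum of the twist becomes the insertion sum for ** *)
have := insertion_sum_wbrace hD dL dR dA (twcat1l hD hF) (twcat1r hD hF)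
  (sgn_twcat hD F) usq
  (leqnn (size s)) (leqnn _).
rewrite !take_size => <-; rewrite szu /gbrace (lin_sum fsharp_linear).
apply: eq_bigr => j _; rewrite (linZ fsharp_linear); congr (_ *: _).
rewrite (big_morph fsharp fsharp_tcat (fsharp_inR _)); apply: eq_bigr => i _.
case: pickP => [l _|_]; last exact: fsharp_inH.
by rewrite usE fsharp_dact //; move/allP: ag; apply; rewrite mem_nth.
Qed.

Lemma tbrace_linl us : linear (fun t : T => tbrace t us).
Proof.
have -> : (fun t : T => tbrace t us) = (fun t : T => rbrace t (rev us)).
  by apply: funext => t; rewrite tbraceE.
exact: rbrace_linl.
Qed.

Lemma tbrace_linr t us1 us2 : linear (fun u : T => tbrace t (us1 ++ u :: us2)).
Proof.
move=> c x y; rewrite !(tbraceE hD) !rev_cat !rev_cons -!cats1 -!catA.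
exact: rbrace_linr.
Qed.

(** Both sides are evaluated on representatives, so generators suffice. *)
Lemma fsharp_tbrace t us : fsharp (tbrace t us) =
  tbrace (fsharp t) (map fsharp us).
Proof.
have E g : fsharp (mlift (gbrace (twist F) g) us) =
    tbrace (fsharp (gval (twist F) g)) (map fsharp us).
  rewrite (mlift_comp _ _ fsharp_linear).
  apply: (mlift_eval (G := fun us => tbrace (fsharp (gval (twist F) g))
    (map fsharp us))).
    move=> us1 us2 c x y; rewrite !map_cat !map_cons fsharp_linear.
    exact: tbrace_linr.
  by move=> gs _ ag; apply: fsharp_gbrace.
rewrite (tlift_comp _ _ fsharp_linear).
apply: (tlift_eval (G := fun t => tbrace (fsharp t) (map fsharp us))) =>
  [|r|x s].
- exact: (linear_comp (tbrace_linl _) fsharp_linear).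
- exact: E.
- exact: E.
Qed.

Local Notation E := (emb2 F).

(** With F written as a twisted product of letters, rbrace_twcat_app computes
    all its braces. *)
Lemma emb2_twcat : E = inH 1 ** inH 1.
Proof. by apply: eq_hlift => x y;
  rewrite !(act_inH hD) !mulr1 (tcat_ten hB). Qed.

Lemma rbrace_inH x us : rbrace (inH x) us =
  match us with [::] => inH x | [:: u] => act x u | _ => 0 end.
Proof.
have cL := tcat_linl hB.
rewrite (rbrace_ten hD) /=; case: us => [|u [|v us]].
- by rewrite addr0 (tcat1l hB).
- rewrite (tcat0l hB) add0r /sprod (graded_sgn (graded_inR D _)) expr0 scale1r.
  by rewrite !(tcat1l hB) degpart_split.
- by rewrite (tcat0l hB) add0r (lin0 (sprod_linl cL _)).
Qed.

Lemma rbrace_inH0 x : rbrace (inH x) [::] = inH x.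
Proof. exact: rbrace_inH. Qed.

Lemma rbrace_inH1 x u : rbrace (inH x) [:: u] = act x u.
Proof. exact: rbrace_inH. Qed.

Lemma rbrace_inH2 x u v : rbrace (inH x) [:: u; v] = 0.
Proof. exact: rbrace_inH. Qed.

(** The two outer terms of the differential. *)
Lemma tbrace_E1 u : tbrace E [:: u] = u ** inH 1 - inH 1 ** sgn u.
Proof.
rewrite (tbraceE hD) -[rev _]/[:: u] emb2_twcat (rbrace_twcat_app hD)
  rbrace_inH1 rbrace_inH0 !(act1 hD); congr (_ + _).
rewrite /sprod (graded_sgn (graded_ten D [:: _])) expr1 scaleN1r.
by rewrite (linN (dL _)) -(linB (dR _)) /sgn -(linN (dR _)) opprB.
Qed.

(** F being a product of two letters, there is one family of positions; the sign
    of the second argument is the one recorded by sprod. *)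
Lemma tbrace_E2 u v : tbrace E [:: u; v] = sprod (twcat F) u v.
Proof.
rewrite (tbraceE hD) -[rev _]/[:: v; u] emb2_twcat (rbrace_twcat_app hD)
  rbrace_inH2 rbrace_inH1 !(act1 hD).
by rewrite (lin0 (dL _)) add0r.
Qed.

Lemma iterbraceE x s : iterbrace F x s = fsharp_word (x :: s).
Proof.
rewrite /iterbrace /fsharp_word /= (twcat1l hD hF).
elim: s (inH x) => //= y s IH t; rewrite IH tbrace_E2; congr foldl.
exact: (sprod_graded dR _ (graded_ten D [:: y])).
Qed.

Lemma graded_E : graded 2 E.
Proof. by rewrite emb2_twcat; apply: (graded_twcat_app hD);
  exact: (graded_ten D [:: 1]). Qed.

(** As F has degree two, the second term of the bracket with its sign is
    (-1)^n u{F} for u of degree n. The definition of the bracket runs over a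
    representative of F, which may involve words of any length; hence the
    bilinear expression G valid in all degrees. *)
Lemma gerstE u : gerst E u = tbrace E [:: u] + tbrace (sgn u) [:: E].
Proof.
pose G (t u : T) := tbrace t [:: u]
  - (tbrace u [:: degpart odd t] - tbrace (sgn u) [:: degpart (predC odd) t]).
have sL := @sgn_linear _ _ _ D; have hL P := @degpart_linear _ _ _ D P.
have bR t : linear (fun u => tbrace t [:: u]) := tbrace_linr t [::] [::].
have GR t : linear (G t).
  apply: linear_add => //; apply: linear_opp; apply: linear_add.
    exact: tbrace_linl.
  apply: linear_opp; exact: (linear_comp (tbrace_linl _) sL).
have GL v : linear (G ^~ v).
  apply: linear_add; first exact: tbrace_linl.
  apply: linear_opp; apply: linear_add;
    first exact: (linear_comp (bR _) (hL _)).
  by apply: linear_opp; exact: (linear_comp (bR _) (hL _)).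
have -> : gerst E u = G E u.
  have B g g' : tbrace (gval D g) [:: gval D g'] -
      (-1) ^+ ((gdeg g).+1 * (gdeg g').+1) *: tbrace (gval D g') [:: gval D g] =
      G (gval D g) (gval D g').
    rewrite /G !(graded_gval D g) (graded_sgn (graded_gval D g')).
    rewrite (linZ (tbrace_linl _)) -signr_odd oddM /=.
    congr (_ - _); case: (odd (gdeg g)) => /=; rewrite (lin0 (bR _)).
      by rewrite scaler0 subr0 expr0 scale1r.
    by rewrite signrN signr_odd sub0r scaleNr.
  apply: (tlift_eval (G := G ^~ u)) => // [r|x s];
    apply: tlift_eval => // [r'|x' s']; exact: B.
rewrite /G !graded_E /= (lin0 (bR _)) sub0r opprK.
by [].
Qed.

(** Inserting F, of even degree, in position i gives the sign (-1)^i. *)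
Lemma rbrace_fsharp_word_E s : rbrace (fsharp_word s) [:: E] = \sum_(i < size s)
  (-1) ^+ i *: (fsharp_word (take i s) ** act s`_i E ** fsharp_word
    (drop i.+1 s)).
Proof.
elim/last_ind: s => [|s x IH]; first by rewrite big_ord0 (rbrace_inR hD).
rewrite fsharp_word_rcons (rbrace_twcat_app hD) IH size_rcons big_ord_recr /=;
  congr (_ + _).
  rewrite (lin_sum (dL _)); apply: eq_bigr => i _; rewrite (linZ (dL _)).
  (* Positions before the last letter: the sum for s, multiplied by x. *)
  have is' : (i <= size s)%N := ltnW (ltn_ord i).
  have -> : take i (rcons s x) = take i s by rewrite -cats1 takel_cat.
  have -> : (rcons s x)`_i = s`_i by rewrite nth_rcons ltn_ord.
  have -> : drop i.+1 (rcons s x) = rcons (drop i.+1 s) x by rewrite drop_rcons.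
  by rewrite fsharp_word_rcons dA.
have -> : take (size s) (rcons s x) = s by rewrite -cats1 take_size_cat.
have -> : (rcons s x)`_(size s) = x by rewrite nth_rcons ltnn eqxx.
have -> : drop (size s).+1 (rcons s x) =
  [::] by rewrite drop_oversize ?size_rcons.
rewrite [fsharp_word [::]]/= (twcat1r hD hF).
have aE : graded 2 (act x E).
  by move=> P; rewrite (degpart_act hD) graded_E; case: (P _);
    rewrite ?(lin0 (act_linr hD x)).
rewrite (sprod_graded dR _ aE) (rbrace_nil hD)
  (graded_sgn (graded_fsharp_word s)) (linZ (dL _)).
by [].
Qed.

End Comparison.

(** * Differentials and products *)

Section Structure.
Variables (K : fieldType) (R : lmodType K) (H : algType K) (D : hopf_data R H).
Variable F : htens (src D) (tgt D).
Hypothesis hD : hopf_algebroid D.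
Hypothesis hF : twistor F.
Local Notation T := (tpow D).
Local Notation inH := (inH D).
Local Notation "A ** B" := (twcat F A B) (at level 40, left associativity).
Local Notation fsharp := (@fsharp K R H D F).
Local Notation E := (emb2 F).

Let dL := twcat_linl F hD.
Let dR := twcat_linr F hD.
Let pL := fsharp_linear hD hF.

Lemma fsharp_comul x : fsharp
  (emb2 (twcomul F x : htens (src (twist F)) (tgt (twist F)))) = act x E.
Proof.
rewrite (emb2_twcat F hD) (act_twcat_twcomul hD hF) (hlift_comp _ _ pL).
apply: eq_hlift => y z; rewrite (fsharp_ten hD hF) !(act_inH hD) !mulr1.
by rewrite -[[:: y; z]]/(rcons [:: y] z) fsharp_word_rcons (fsharp_word1 hD hF).
Qed.

Let sg n a : (a < n)%N -> - (-1) ^+ (n - a.+1) = (-1) ^+ n * (-1) ^+ a :> K.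
Proof.
move=> an; rewrite -{2}(subnKC an) addSnnS exprD mulrAC -expr2 sqrr_sign mul1r.
by rewrite exprS mulN1r.
Qed.

Lemma fsharp_gdiff g :
  fsharp (gdiff (twist F) g) = gerst E (fsharp (gval (twist F) g)).
Proof.
rewrite (gerstE F hD) (tbrace_E1 F hD).
rewrite (graded_sgn (graded_fsharp hD hF g)) (linZ (dR _))
  (linZ (tbrace_linl hD _)).
rewrite /gdiff !(linB pL) (linZ pL) !(fsharp_tcat hD hF) (fsharp_inH hD hF).
rewrite -[RHS]addrA [in RHS](addrC (- _)) addrA; congr (_ - _); congr (_ + _).
(* There remain u{F} and the terms that contain a coproduct. *)
rewrite (tbraceE hD) -[rev _]/[:: E]; case: g => [r|s].
  rewrite -[gval _ _]/(Defs.inR (twist F) r) (fsharp_inR hD hF) (rbrace_inR hD).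
  by rewrite (lin0 pL) oppr0 scaler0.
rewrite -[gval _ _]/(ten (twist F) s) (fsharp_ten hD hF)
  (rbrace_fsharp_word_E hD hF).
rewrite (lin_sum pL) -sumrN scaler_sumr; apply: eq_bigr => i _.
rewrite (linZ pL) !(fsharp_tcat hD hF) !(fsharp_ten hD hF) fsharp_comul scalerA
  -scaleNr.
congr (_ *: _); exact: sg.
Qed.

Lemma fsharp_tdiff t : fsharp (tdiff t) = gerst E (fsharp t).
Proof.
have GL : linear (fun u : T => gerst E u).
  have -> : (fun u : T => gerst E u) =
      (fun u => tbrace E [:: u] + tbrace (sgn u) [:: E]).
    by apply: funext => u; rewrite (gerstE F hD).
  apply: linear_add; first exact: (tbrace_linr hD E [::] [::]).
  exact: (linear_comp (tbrace_linl hD _) (@sgn_linear _ _ _ D)).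
rewrite (tlift_comp _ _ pL).
apply: (tlift_eval (G := fun t => gerst E (fsharp t))) => [|r|x s].
- exact: (linear_comp GL pL).
- exact: fsharp_gdiff.
- exact: fsharp_gdiff.
Qed.

Lemma tcupFE t u : tcupF F t u = sprod (twcat F) (sgn t) u.
Proof.
have sL := @sgn_linear _ _ _ D.
have Eg g : (-1) ^+ gdeg g *: tbrace E [:: gval D g; u] =
    sprod (twcat F) (sgn (gval D g)) u.
  rewrite (graded_sgn (graded_gval D g)) (linZ (sprod_linl dL _)).
  by rewrite (tbrace_E2 F hD).
apply: (tlift_eval (G := fun t => sprod (twcat F) (sgn t) u)) => [|r|x s].
- exact: (linear_comp (sprod_linl dL _) sL).
- exact: Eg.
- exact: Eg.
Qed.

(** For degrees m and n the sign (-1)^m of the twisted cup product and the sign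
    (-1)^(m (n + 1)) of F{u, v} multiply to (-1)^(m n), the sign of the cup
    product. *)
Lemma fsharp_tcup t u : fsharp (tcup t u) = tcupF F (fsharp t) (fsharp u).
Proof.
have sL := @sgn_linear _ _ _ D.
rewrite tcupFE (tlift_comp _ _ pL).
have Eg g g' : fsharp ((-1) ^+ (gdeg g * gdeg g') *:
      tcat (gval (twist F) g) (gval (twist F) g')) =
    sprod (twcat F) (sgn (fsharp (gval (twist F) g)))
      (fsharp (gval (twist F) g')).
  rewrite (linZ pL) (fsharp_tcat hD hF)
    (sprod_graded dR _ (graded_fsharp hD hF g')).
  rewrite sgnK (graded_sgn (graded_fsharp hD hF g)) -signr_odd oddM.
  case: (odd (gdeg g')); rewrite ?andbT ?andbF ?expr0 ?scale1r //.
  by rewrite signr_odd (linZ (dL _)).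
have Eu g : fsharp (tlift (fun g' => (-1) ^+ (gdeg g * gdeg g') *:
      tcat (gval (twist F) g) (gval (twist F) g')) u) =
    sprod (twcat F) (sgn (fsharp (gval (twist F) g))) (fsharp u).
  rewrite (tlift_comp _ _ pL).
  apply: (tlift_eval (G := fun u => sprod _ (sgn (fsharp _)) (fsharp u))) =>
    [|r|x s].
  - exact: (linear_comp (sprod_linr dR _) pL).
  - exact: Eg.
  - exact: Eg.
apply: (tlift_eval (G := fun t => sprod (twcat F) (sgn (fsharp t)) (fsharp u)))
  => [|r|x s].
- exact: (linear_comp (sprod_linl dL _) (linear_comp sL pL)).
- exact: Eu.
- exact: Eu.
Qed.
End Structure.

(** * Bijectivity *)

Section TensorModule.
Variables (K : fieldType) (R : lmodType K) (H : algType K) (D : hopf_data R H).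

(** A copy of the total space, so that its structure of module over H does not
    clash with that of vector space over K. *)
Definition tmod of hopf_algebroid D : Type := tpow D.

Variable hD : hopf_algebroid D.

HB.instance Definition _ := GRing.Zmodule.on (tmod hD).

Let actt (h : H) (t : tmod hD) : tmod hD := act h (t : tpow D).

Lemma tmod_actA a b t : actt a (actt b t) = actt (a * b) t.
Proof. by rewrite /actt (actM hD). Qed.

Lemma tmod_act1 : left_id 1 actt.
Proof. exact: (act1 hD). Qed.

Lemma tmod_actDr : right_distributive actt +%R.
Proof. by move=> a t u; exact: (linD (act_linr hD a)). Qed.

Lemma tmod_actDl t : {morph actt^~ t : a b / a + b}.
Proof. by move=> a b; exact: (linD (act_linl hD (t : tpow D))). Qed.

HB.instance Definition _ := GRing.Zmodule_isLmodule.Build H (tmod hD)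
  tmod_actA tmod_act1 tmod_actDr tmod_actDl.
End TensorModule.

Section Inverse.
Variables (K : fieldType) (R : lmodType K) (H : algType K) (D : hopf_data R H).
Variable F : htens (src D) (tgt D).
Hypothesis hD : hopf_algebroid D.
Hypothesis hF : twistor F.
Let hB : base_axioms D := hopf_base hD.
Let hB' : base_axioms (twist F) := twist_base hD hF.
Local Notation T := (tpow D).
Local Notation T' := (tpow (twist F)).
Local Notation ten := (ten D).
Local Notation inR := (inR D).
Local Notation inH := (inH D).
Local Notation "A ** B" := (twcat F A B) (at level 40, left associativity).
Local Notation fsharp := (@fsharp K R H D F).
Local Notation Tm := (tmod hD : lmodType H).
Local Notation TH := (tens (src D) (tgt D) Tm H^o).
Local Notation TH' := (tens (twsrc F) (twtgt F) Tm H^o).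
Local Notation tp := (@tpair K R H (src D) (tgt D) Tm H^o).
Local Notation tp' := (@tpair K R H (twsrc F) (twtgt F) Tm H^o).

Let dL := twcat_linl F hD.
Let dR := twcat_linr F hD.
Let pL := fsharp_linear hD hF.

Let scalT c (t u : Tm) : c%:A *: t + u = c *: (t : T) + u :> T.
Proof. by congr (_ + _); exact: (act_scalar hD). Qed.

Let scalH c (h k : H^o) : c%:A *: h + k = c *: (h : H) + k :> H.
Proof. by congr (_ + _); exact: mulr_algl. Qed.

Let tgtT r (t : Tm) : tgt D r *: t = tcat (t : T) (inR r) :> T.
Proof. exact: (act_tgt1 hD). Qed.

Let twtgtT r (t : Tm) : twtgt F r *: t = (t : T) ** inR r :> T.
Proof. by rewrite (twcat_inRr F hD). Qed.

Lemma tp_linl h : linear (fun t : T => tp t h).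
Proof.
move=> c t u; rewrite -(tbal_l (tpair_balanced (src D) (tgt D) Tm H^o)).
by congr (tp (_ + _) _); rewrite -[RHS]/(act _ _) (act_scalar hD).
Qed.

Lemma tp_linr (t : T) : linear (fun h : H => tp t h).
Proof.
move=> c h k; rewrite -(tbal_r (tpair_balanced (src D) (tgt D) Tm H^o)).
by congr (tp _ (_ + _)); rewrite -[RHS]/(_%:A * _) mulr_algl.
Qed.

Lemma tp_bal (t : T) r h : tp (tcat t (inR r)) h = tp t (src D r * h).
Proof.
rewrite -(act_tgt1 hD).
exact: (tbal_m (tpair_balanced (src D) (tgt D) Tm H^o) r t h).
Qed.

(** Splits off the last letter; the empty word left over from a word of length
    one is the unit of R. *)
Definition unapp_word (s : seq H) : TH :=
  if rev s is x :: s' then tp (ten (rev s')) x else 0.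

Lemma unapp_rcons s x : unapp_word (rcons s x) = tp (ten s) x.
Proof. by rewrite /unapp_word rev_rcons revK. Qed.

Definition unapp (t : T) : TH :=
  tlift (fun g => if g is inr s then unapp_word s else 0) t.

Lemma unapp_balanced :
  gen_balanced D (fun g => if g is inr s then unapp_word s else 0).
Proof.
have tw := ten_word_balanced D.
split; first exact: linear_zero.
split=> [s1 s2|r x y s1 s2].
  case/lastP: s2 => [|s2 z] c x y.
    by rewrite !cats1 !unapp_rcons tp_linr.
  by rewrite -!rcons_cons -!rcons_cat !unapp_rcons (wbal_l tw) tp_linl.
case/lastP: s2 => [|s2 z].
  have E u v : s1 ++ [:: u; v] = rcons (rcons s1 u) v.
    by rewrite -!cats1 -catA.
  by rewrite !E !unapp_rcons -(tcat_WR hB) tp_bal.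
by rewrite -!rcons_cons -!rcons_cat !unapp_rcons (wbal_m tw).
Qed.

Lemma unapp_linear : linear unapp.
Proof. exact/tlift_linear/unapp_balanced. Qed.

Lemma unapp_inR r : unapp (inR r) = 0.
Proof. exact: (tlift_inR unapp_balanced). Qed.

Lemma unapp_ten s x : unapp (ten (rcons s x)) = tp (ten s) x.
Proof.
rewrite -unapp_rcons; case: s => [|y s]; exact: (tlift_ten unapp_balanced).
Qed.

Lemma unapp_app t x : unapp (tcat t (inH x)) = tp t x.
Proof.
move: t; apply: tpow_ext => [||r|y s].
- exact: (linear_comp unapp_linear (tcat_linl hB _)).
- exact: tp_linl.
(* The letter alpha(r) x is preceded by the unit of R, onto which r moves. *)
- rewrite (tcat_RW hB) (unapp_ten [::]) -tp_bal; congr (tp _ _).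
  exact: (tcat1l hB).
- by rewrite -(ten_rcons hB) unapp_ten.
Qed.

Definition app (u : TH) : T :=
  plift (fun d : Tm * H^o => tcat (d.1 : T) (inH d.2)) u.

Lemma app_balanced :
  tens_balanced (src D) (tgt D)
    (fun (t : Tm) (h : H^o) => tcat (t : T) (inH h)).
Proof.
split=> [c t u h|c t h k|r t h].
- exact: etrans (congr1 (fun t => tcat t (inH h)) (scalT c t u))
  (tcat_linl hB _ _ _ _).
- apply: etrans (congr1 (fun h => tcat (t : T) (inH h)) (scalH c h k)) _.
  exact: (linear_comp (tcat_linr hB _) (@inH_linear _ _ _ D)).
- apply: etrans (congr1 (fun t => tcat t (inH h)) (tgtT r t)) _.
  by rewrite -(tcatA hB) (tcat_RW hB).
Qed.

Lemma app_linear : linear app.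
Proof. exact: tenslift_linear app_balanced. Qed.

Lemma app_pair t h : app (tp t h) = tcat t (inH h).
Proof. exact: (tenslift_pair app_balanced). Qed.

(** The positive part of T is T (x)_R H. *)
Lemma app_unapp t : t = inR t.1 + app (unapp t).
Proof.
have fL : linear (fun t : T => t.1) by [].
move: t; apply: tpow_ext => [||r|x s]; first exact: linear_id.
- apply: linear_add; first exact: (linear_comp (@inR_linear _ _ _ D) fL).
  exact: (linear_comp app_linear unapp_linear).
- by rewrite unapp_inR (lin0 app_linear) addr0.
- rewrite (lin0 (@inR_linear _ _ _ D)) add0r.
  by rewrite lastI unapp_ten app_pair (ten_rcons hB).
Qed.

Lemma app_fst t x : (tcat t (inH x)).1 = 0.
Proof.
have fL : linear (fun t : T => t.1) by [].
move: t; apply: tpow_ext => [||r|y s].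
- exact: (linear_comp fL (tcat_linl hB _)).
- exact: linear_zero.
- by rewrite (tcat_RW hB).
- by rewrite (tcat_ten hB).
Qed.

Lemma twcat_fst t x : (t ** inH x).1 = 0.
Proof.
have fL : linear (fun t : T => t.1) by [].
rewrite (hlift_comp _ _ fL).
apply: (hlift_eval (g := fun=> 0)) => [|y z]; first exact: linear_zero.
by rewrite (act_inH hD) app_fst.
Qed.

Local Notation sharp := (@twsharp K R H D F Tm H^o).

Let sharp_gen (t : Tm) (h : H^o) : TH :=
  hlift (fun x y => tpair (src D) (tgt D) (x *: t) (y *: h)) F.

Lemma unapp_twcat (t : T) h : unapp (t ** inH h) = sharp_gen t h.
Proof.
rewrite (hlift_comp _ _ unapp_linear); apply: eq_hlift => x y.
by rewrite (act_inH hD) unapp_app.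
Qed.

Lemma sharp_balanced : tens_balanced (twsrc F) (twtgt F) sharp_gen.
Proof.
have L1 h : linear (fun t : T => unapp (t ** inH h)).
  exact: (linear_comp unapp_linear (dL _)).
have L2 t : linear (fun h : H => unapp (t ** inH h)).
  exact: (linear_comp unapp_linear (linear_comp (dR t) (@inH_linear _ _ _ D))).
split=> [c t u h|c t h k|r t h]; rewrite -!unapp_twcat.
- exact: etrans (congr1 (fun t => unapp (t ** inH h)) (scalT c t u))
  (L1 h c t u).
- exact: etrans (congr1 (fun h => unapp ((t : T) ** inH h)) (scalH c h k))
  (L2 t c h k).
- apply: etrans (congr1 (fun t => unapp (t ** inH h)) (twtgtT r t)) _.
  by rewrite -(twcatA hD hF) (twcat_RH F hD).
Qed.

Lemma sharp_linear : linear sharp.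
Proof. exact: tenslift_linear sharp_balanced. Qed.

(** Under the identification of T (x)_R H with the positive part of T, the map
    F^sharp is the twisted product with a letter. *)
Lemma sharp_pair t h : sharp (tp' t h) = unapp (t ** inH h).
Proof. by rewrite unapp_twcat; exact: (tenslift_pair sharp_balanced). Qed.

Lemma app_sharp_pair t h : app (sharp (tp' t h)) = t ** inH h.
Proof.
rewrite sharp_pair [RHS]app_unapp twcat_fst (lin0 (@inR_linear _ _ _ D)).
by rewrite add0r.
Qed.

Variable unsharp : TH -> TH'.
Hypotheses (sharpK : cancel sharp unsharp) (unsharpK : cancel unsharp sharp).

Lemma unsharp_linear : linear unsharp.
Proof.
move=> c u v; apply: (can_inj sharpK).
by rewrite sharp_linear !unsharpK.
Qed.

(** Surjectivity of F^sharp. Unlike in tpow_ind nothing is assumed about t in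
    the last case, as its degree is not controlled; this is why the inverse
    below is indexed by a bound on the degree. *)
Lemma twcat_ind (P : T -> Prop) :
  (forall c t u, P t -> P u -> P (c *: t + u)) ->
  (forall r, P (inR r)) -> (forall t x, P (t ** inH x)) -> forall t, P t.
Proof.
move=> PL PR Px t.
have P0 : P 0 by rewrite -(lin0 (@inR_linear _ _ _ D)); exact: PR.
have [s [us _]] := presP (unsharp (unapp t)).
rewrite (app_unapp t) -[inR _]scale1r; apply: (PL _ _ _ (PR _)).
rewrite -(unsharpK (unapp t)) us (lin_comb sharp_linear) (lin_comb app_linear).
elim: s {us} => [|[c [m h]] s IH]; rewrite ?big_nil ?big_cons //.
by apply: (PL) => //; rewrite -[pgen _ _]/(tp' m h) app_sharp_pair.
Qed.

(** Inverse to the comparison map in degrees below n: write the positive part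
    of t as a combination of products m ** h by means of the inverse of F^sharp
    and invert m recursively. *)
Fixpoint fsharp_inv n (t : T) : T' :=
  if n is m.+1 then
    Defs.inR (twist F) t.1 +
    plift (fun d : Tm * H^o => tcat (fsharp_inv m (d.1 : T))
      (Defs.inH (twist F) d.2))
      (unsharp (unapp t))
  else 0.

Lemma fsharp_inv_balanced n : linear (fsharp_inv n) ->
  (forall t r, fsharp_inv n (t ** inR r) =
    tcat (fsharp_inv n t) (Defs.inR (twist F) r)) ->
  tens_balanced (twsrc F) (twtgt F) (fun (t : Tm) (h : H^o) =>
    tcat (fsharp_inv n (t : T)) (Defs.inH (twist F) h)).
Proof.
move=> nL nR; pose f (t : T) h := tcat (fsharp_inv n t) (Defs.inH (twist F) h).
have L1 h : linear (f ^~ h) by exact: (linear_comp (tcat_linl hB' _) nL).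
have L2 t : linear (f t).
  exact: (linear_comp (tcat_linr hB' _) (@inH_linear _ _ _ (twist F))).
split=> [c t u h|c t h k|r t h].
- exact: etrans (congr1 (f ^~ h) (scalT c t u)) (L1 h c t u).
- exact: etrans (congr1 (f t) (scalH c h k)) (L2 t c h k).
- apply: etrans (congr1 (f ^~ h) (twtgtT r t)) _.
  by rewrite /f nR -(tcatA hB') (tcat_RW hB').
Qed.

(** The right R_F-linearity at stage n makes stage n + 1 well defined and yields
    its recursion, which in turn gives linearity at stage n + 1. *)
Lemma fsharp_inv_props n : linear (fsharp_inv n) /\
  (forall t r, fsharp_inv n (t ** inR r) =
    tcat (fsharp_inv n t) (Defs.inR (twist F) r)) /\
  (forall t h, fsharp_inv n.+1 (t ** inH h) =
    tcat (fsharp_inv n t) (Defs.inH (twist F) h)).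
Proof.
have iL := @inR_linear _ _ _ (twist F).
have fL : linear (fun t : T => t.1) by [].
have next m : linear (fsharp_inv m) ->
    (forall t r, fsharp_inv m (t ** inR r) =
      tcat (fsharp_inv m t) (Defs.inR (twist F) r)) ->
    linear (fsharp_inv m.+1) /\
    forall t h, fsharp_inv m.+1 (t ** inH h) =
      tcat (fsharp_inv m t) (Defs.inH (twist F) h).
  move=> mL mR; have B := fsharp_inv_balanced mL mR; split.
    apply: linear_add; first exact: (linear_comp iL fL).
    apply: (linear_comp (tenslift_linear B)).
    exact: (linear_comp unsharp_linear unapp_linear).
  move=> t h; rewrite /= twcat_fst (lin0 iL) add0r -sharp_pair sharpK.
  exact: (tenslift_pair B).
elim: n => [|n [nL [nR nH]]].
  have L0 : linear (fsharp_inv 0) by exact: linear_zero.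
  have R0 t r : fsharp_inv 0 (t ** inR r) =
    tcat (fsharp_inv 0 t) (Defs.inR (twist F) r).
    by rewrite (tcat0l hB').
  by split=> //; split=> //; case: (next 0%N L0 R0).
have [L _] := next n nL nR.
have R1 t r : fsharp_inv n.+1 (t ** inR r) =
  tcat (fsharp_inv n.+1 t) (Defs.inR (twist F) r).
  elim/twcat_ind: t => [c t u Et Eu|a|t x].
  - by rewrite dL !L (tcat_linl hB') Et Eu.
  - have E b : fsharp_inv n.+1 (inR b) = Defs.inR (twist F) b.
      rewrite /= unapp_inR (lin0 unsharp_linear).
      by rewrite (lin0 (tenslift_linear (fsharp_inv_balanced nL nR))) addr0.
    by rewrite (twcat_RR F hD) !E (tcat_RR hB').
  - rewrite -(twcatA hD hF) (twcat_HR F hD) !nH -(tcatA hB'); congr (tcat _ _).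
    by rewrite (tcat_WR hB' [::]).
by split=> //; split=> //; case: (next n.+1 L R1).
Qed.

Lemma fsharp_inv_inR n r : fsharp_inv n.+1 (inR r) = Defs.inR (twist F) r.
Proof.
have [nL [nR _]] := fsharp_inv_props n.
rewrite /= unapp_inR (lin0 unsharp_linear).
by rewrite (lin0 (tenslift_linear (fsharp_inv_balanced nL nR))) addr0.
Qed.

Lemma fsharp_fsharp_inv n t : fsharp (fsharp_inv n t) =
  degpart (fun k => (k < n)%N) t.
Proof.
have hL P := @degpart_linear _ _ _ D P.
elim: n t => [|n IH] t; first by rewrite (lin0 pL) degpart_false.
have [nL [_ nH]] := fsharp_inv_props n; have [nL1 _] := fsharp_inv_props n.+1.
elim/twcat_ind: t => [c t u Et Eu|r|t x].
- by rewrite nL1 pL Et Eu hL.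
- by rewrite fsharp_inv_inR (fsharp_inR hD hF) degpart_inR.
- by rewrite nH (fsharp_tcat_inH hD hF) IH (degpart_twcat_app hD).
Qed.

Lemma fsharp_inv_fsharp n t : fsharp_inv n (fsharp t) =
  degpart (fun k => (k < n)%N) t.
Proof.
elim/(tpow_ind hB'): t n => [c t u Et Eu|r|t x E] n.
- by have [nL _] := fsharp_inv_props n; rewrite pL nL Et Eu degpart_linear.
- case: n => [|n]; first by rewrite degpart_false.
  by rewrite (fsharp_inR hD hF) fsharp_inv_inR degpart_inR.
- case: n => [|n]; first by rewrite degpart_false.
  have [_ [_ nH]] := fsharp_inv_props n.
  by rewrite (fsharp_tcat_inH hD hF) nH E (degpart_app hB').
Qed.
End Inverse.

(** A given tensor lies in bounded degree, where the truncated inverse is a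
    true one. *)
Lemma fsharp_bij (K : fieldType) (R : lmodType K) (H : algType K)
    (D : hopf_data R H) (F : htens (src D) (tgt D)) :
  hopf_algebroid D -> twistor F -> bijective (@fsharp K R H D F).
Proof.
move=> hD hF; have hB := hopf_base hD; have hB' := twist_base hD hF.
have [g sK Ks] := tw_inv hF (tmod hD : lmodType H) H^o.
have fsharp_inj : injective (@fsharp K R H D F).
  move=> t u tu; have [n En] := degpart_bound hB' t;
    have [m Em] := degpart_bound hB' u.
  rewrite -(En (maxn n m)) ?leq_maxl // -(Em (maxn n m)) ?leq_maxr //.
  by rewrite -!(fsharp_inv_fsharp hF sK Ks) tu.
exists (fun u => xget 0 [set t | fsharp t = u]) => u.
  by apply: fsharp_inj; case: xgetP => [t _ //|/(_ u)]; case.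
case: xgetP => [t _ //|].
have [n En] := degpart_bound hB u.
by move=> /(_ (fsharp_inv g n u)); case;
  rewrite /= (fsharp_fsharp_inv hF sK Ks) En.
Qed.

Theorem theorem2 (K : fieldType) (charK : [pchar K] =i pred0)
    (R : lmodType K) (H : algType K) (D : hopf_data R H)
    (hD : hopf_algebroid D)
    (F : htens (src D) (tgt D)) (hF : twistor F) :
  exists Fsharp : bcar (canonical_binf (twist F)) -> bcar (twisted_binf F),
    [/\ forall r : R, Fsharp (inR (twist F) r) = inR D r,
        forall (x : H) (s : seq H),
          Fsharp (ten (twist F) (x :: s)) = iterbrace F x s &
        strict_binf_iso Fsharp].
Proof.
exists (@fsharp K R H D F); split=> [r|x s|].
- exact: (fsharp_inR hD hF).
- by rewrite (fsharp_ten hD hF) (iterbraceE hD hF).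
split; last exact: fsharp_bij.
split.
- exact: (fsharp_linear hD hF).
- move=> n t; exact: (fsharp_homog hD hF).
- exact: (fsharp_tdiff hD hF).
- exact: (fsharp_tcup hD hF).
- exact: (fsharp_tbrace hD hF).
Qed.
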